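(* Let $E$ be a smooth compact submanifold of codimension $k$ in $\mathbb{R}^n$. If there exists a nonzero $f \in C_c(\mathbb{R}^n)$ such that $\hat{f}$ vanishes on $E$, then $E$ is not a set of $p$-restriction for $p > \frac{2n}{n+k}$.
   Context: Here $n\ge 2$ is an integer and $p \in [1,\infty]$. $C_c(\mathbb{R}^n)$ is the space of continuous functions on $\mathbb{R}^n$ with compact support, and $\mathcal{S}(\mathbb{R}^n)$ is the Schwartz space. For $f\in L^1(\mathbb{R}^n)$, $\hat f(\xi)=\int_{\mathbb{R}^n} e^{-2\pi i x\cdot \xi} f(x)\,dx$. Let $d\sigma$ be the measure induced on $E$ by Lebesgue measure (surface measure) and $L^1(E)=L^1(E,d\sigma)$. The restriction operator associated with $E$ is $\mathcal{R}_E(f)=\hat f|_E$, $f\in\mathcal{S}(\mathbb{R}^n)$. $E$ is called a set of $p$-restriction if $\mathcal{R}_E$ extends to a continuous operator from $L^p(\mathbb{R}^n)$ to $L^1(E)$, equivalently if there is a constant $C$ with $\Vert \hat f|_E\Vert_{L^1(E)}\le C\Vert f\Vert_{L^p}$ for all $f\in\mathcal{S}(\mathbb{R}^n)$. *)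

(* Defs.v *)
From HB Require Import structures.
From mathcomp Require Import all_boot all_order all_algebra.
From mathcomp Require Import all_classical all_reals all_analysis.
From mathcomp Require Import complex.

Set Implicit Arguments.
Unset Strict Implicit.
Unset Printing Implicit Defensive.

Import Order.TTheory GRing.Theory Num.Theory.
Import numFieldNormedType.Exports.

Local Open Scope classical_set_scope.
Local Open Scope ring_scope.

(* The sigma-algebra on R^n generated by the coordinates, i.e. the Borel
   sigma-algebra. *)
Section measurable_rV.
Variables (R : realType) (n : nat).

Definition rV_coord (i : 'I_n) (v : 'rV[R]_n) : measurableTypeR R := v ord0 i.

Let rV_set0 : g_sigma_preimage rV_coord set0.
Proof. exact: sigma_algebra0. Qed.

Let rV_setC A : g_sigma_preimage rV_coord A -> g_sigma_preimage rV_coord (~` A).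
Proof. exact: sigma_algebraC. Qed.

Let rV_bigcup (F : (set 'rV[R]_n)^nat) :
  (forall i, g_sigma_preimage rV_coord (F i)) ->
  g_sigma_preimage rV_coord (\bigcup_i (F i)).
Proof. exact: sigma_algebra_bigcup. Qed.

Definition rV_display : measure_display.
Proof. exact: (measure_tuple_display default_measure_display). Qed.

HB.instance Definition _ := @isMeasurable.Build rV_display
  'rV[R]_n (g_sigma_preimage rV_coord) rV_set0 rV_setC rV_bigcup.

End measurable_rV.

Section lebesgue_measure_rV.
Variable R : realType.

Definition consrV n (xv : measurableTypeR R * 'rV[R]_n) : 'rV[R]_n.+1 :=
  row_mx (xv.1)%:M xv.2.

Lemma measurable_consrV n : measurable_fun [set: _] (@consrV n).
Proof.
apply: measurability; first by [].
move=> _ [B + <-]; rewrite -bigcup_seq => -[/= i _ [A mA <-]].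
rewrite !setTI -comp_preimage -[X in measurable X]setTI.
suff mi : measurable_fun [set: _] (@rV_coord R n.+1 i \o @consrV n) by exact: mi.
have [j ->|j ->] := split_ordP (i : 'I_(1 + n)).
- rewrite (_ : _ \o _ = fst); first exact: measurable_fst.
  by apply/funext => xv; rewrite /rV_coord /consrV/= (@row_mxEl _ 1 1) !ord1 mxE eqxx.
- rewrite (_ : _ \o _ = rV_coord j \o snd).
    apply: measurableT_comp; last exact: measurable_snd.
    move=> _ C mC; rewrite setTI; apply: sub_sigma_algebra.
    rewrite -bigcup_seq/=; exists j; first by rewrite /= mem_index_enum.
    by exists C => //; rewrite setTI.
  by apply/funext => xv; rewrite /rV_coord /consrV/= (@row_mxEr _ 1 1).
Qed.

Section lebesgue_consrV.
Variables (n : nat) (mu : {measure set 'rV[R]_n -> \bar R}).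
Local Open Scope ereal_scope.

Definition lebesgue_consrV : set 'rV[R]_n.+1 -> \bar R :=
  pushforward (@lebesgue_measure R \x^ mu) (@consrV n).

Let measurable_preimage (A : set 'rV[R]_n.+1) :
  measurable A -> measurable (@consrV n @^-1` A).
Proof. by move=> mA; rewrite -[X in measurable X]setTI; exact: measurable_consrV. Qed.

Let lebesgue_consrV0 : lebesgue_consrV set0 = 0.
Proof. by rewrite /lebesgue_consrV /pushforward preimage_set0 measure0. Qed.

Let lebesgue_consrV_ge0 A : 0 <= lebesgue_consrV A.
Proof. by apply: (measure_ge0 (@lebesgue_measure R \x^ mu)). Qed.

Let lebesgue_consrV_sigma_additive : semi_sigma_additive lebesgue_consrV.
Proof.
move=> F mF tF mUF; rewrite /lebesgue_consrV /pushforward preimage_bigcup.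
apply: measure_semi_sigma_additive.
- by move=> k; exact: measurable_preimage.
- apply/trivIsetP => i j _ _ ij; rewrite -preimage_setI.
  by move/trivIsetP : tF => ->//; rewrite preimage_set0.
- by rewrite -preimage_bigcup; exact: measurable_preimage.
Qed.

HB.instance Definition _ := isMeasure.Build _ _ _ lebesgue_consrV
  lebesgue_consrV0 lebesgue_consrV_ge0 lebesgue_consrV_sigma_additive.

End lebesgue_consrV.

Fixpoint lebesgue_rV n : {measure set 'rV[R]_n -> \bar R} :=
  if n is m.+1 then lebesgue_consrV (lebesgue_rV m) else \d_(0 : 'rV[R]_0).

End lebesgue_measure_rV.

Section smooth.
Variables (R : realType) (m : nat) (V : normedModType R).
Implicit Types (f : 'rV[R]_m -> V) (U : set 'rV[R]_m).

Definition rV_basis (i : 'I_m) : 'rV[R]_m := delta_mx ord0 i.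

Fixpoint iter_partial (s : seq 'I_m) f : 'rV[R]_m -> V :=
  if s is i :: s' then fun x => 'D_(rV_basis i) (iter_partial s' f) x else f.

(* C^infinity on an open set U: since differentiability implies continuity,
   it amounts to the existence and continuity on U of all iterated partial
   derivatives. *)
Definition smooth_on U f :=
  forall (s : seq 'I_m) x, U x -> differentiable (iter_partial s f) x.

End smooth.

Section submanifold.
Variables (R : realType) (d n : nat).
Implicit Types (E : set 'rV[R]_n) (W : set 'rV[R]_d).
Implicit Types (phi : 'rV[R]_d -> 'rV[R]_n).

(* The last clause says that phi is a homeomorphism from W onto a relatively
   open subset of E. jacobian acts on row vectors (by right product): it is the
   d x n matrix of partial derivatives, so row_free means that the differential
   is injective. *)
Definition local_parametrization E W phi :=
  [/\ open W, smooth_on W phi, set_inj W phi,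
      forall u, W u -> row_free (jacobian phi u) &
      forall V, open V -> V `<=` W ->
        exists2 U, open U & phi @` V = E `&` U].

Definition smooth_submanifold E :=
  forall x, E x -> exists W phi, local_parametrization E W phi /\ (phi @` W) x.

Definition gram_volume phi (u : 'rV[R]_d) : R :=
  Num.sqrt (\det (jacobian phi u *m (jacobian phi u)^T)).

(* The measure induced on the d-dimensional submanifold E by Lebesgue measure,
   seen as a measure on R^n carried by E; for d = 0 it is the counting measure
   on E. *)
Definition is_surface_measure E (sigma : {measure set 'rV[R]_n -> \bar R}) :=
  sigma (~` E) = 0%E /\
  forall W phi, local_parametrization E W phi ->
  forall B, measurable B ->
    sigma (B `&` phi @` W) =
    (\int[lebesgue_rV R d]_(u in W `&` phi @^-1` B) (gram_volume phi u)%:E)%E.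

End submanifold.

Section restriction.
Variables (R : realType) (n : nat).
Implicit Types (f : 'rV[R]_n -> R[i]) (E : set 'rV[R]_n) (p : \bar R).
Implicit Types (sigma : {measure set 'rV[R]_n -> \bar R}).

Definition re f : 'rV[R]_n -> R := fun x => complex.Re (f x).
Definition im f : 'rV[R]_n -> R := fun x => complex.Im (f x).
Definition modulus f : 'rV[R]_n -> \bar R := fun x => (Normc.normc (f x))%:E.

Definition compactly_supported_continuous f :=
  [/\ continuous (re f), continuous (im f) &
      compact (closure [set x | f x != 0])].

Definition dotp (x y : 'rV[R]_n) : R := \sum_(i < n) x ord0 i * y ord0 i.

Definition expi (t : R) : R[i] := Complex (cos t) (sin t).

Definition Cintegral f : R[i] :=
  Complex (\int[lebesgue_rV R n]_x re f x) (\int[lebesgue_rV R n]_x im f x).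

Definition fourier f (xi : 'rV[R]_n) : R[i] :=
  Cintegral (fun x => expi (- (2 * pi * dotp x xi)) * f x).

Definition monomial (a : 'I_n -> nat) (x : 'rV[R]_n) : R :=
  \prod_(i < n) x ord0 i ^+ a i.

Definition real_schwartz (g : 'rV[R]_n -> R) :=
  smooth_on [set: _] g /\
  forall (a : 'I_n -> nat) (s : seq 'I_n),
    exists M : R, forall x, `|monomial a x * iter_partial s g x| <= M.

Definition schwartz f := real_schwartz (re f) /\ real_schwartz (im f).

(* sigma is to be the surface measure of E. *)
Definition p_restriction E sigma p :=
  exists C : R, forall f, schwartz f ->
    (\int[sigma]_(xi in E) modulus (fourier f) xi <=
     C%:E * 'N[lebesgue_rV R n]_p[modulus f])%E.

End restriction.

(* Main.v *)
Require Import Defs.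
From HB Require Import structures.
From mathcomp Require Import all_boot all_order all_algebra.
From mathcomp Require Import all_classical all_reals all_analysis.
From mathcomp Require Import measurable_realfun ess_sup_inf complex.
From mathcomp Require Import polyrcf ring lra.
From mathcomp Require finmap.

Set Implicit Arguments.
Unset Strict Implicit.
Unset Printing Implicit Defensive.

Import Order.TTheory GRing.Theory Num.Theory.
Import numFieldNormedType.Exports.

Local Open Scope classical_set_scope.
Local Open Scope ring_scope.

(** Write d = n - k. The restriction inequality is tested on a Gaussian times a
random exponential sum,
  f_s(x) = exp(- t |x|^2) * sum_j (+/-) exp(2 i pi x.xi_j),
where the signs s range over all choices, the xi_j form a net of E of mesh
O(1/m), and sqrt t is a large constant times 1/m. Charts of E are locally
Lipschitz, so that N = O(m^d) points suffice (covering_bound_submanifold).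
Let M be the integral of the Gaussian; M is proportional to m^n.

The transform of f_s is a signed sum of translates, centred at the xi_j, of the
transform of the Gaussian. At a point of E close to xi_j, the j-th translate is
at least M / 2 (cos_kernel_ge), and the mean over all signs of the modulus of a
signed sum is at least the modulus of any one of its terms
(sum_norm_signed_sum_ge). Hence the mean over s of the L^1(E) norm of the
transform of f_s is at least sigma(E) M / 2. The translates overlap, but this
does no harm, and only an upper bound on N is needed. The measure sigma(E) is
positive because Gram determinants of injective differentials are positive
(surface_measure_gt0).

On the other side, signs are orthogonal, so that the mean over s of the squared
modulus of the exponential sum is N at every point x. Interpolating between this
and the trivial bound O(N), the mean of the L^p norm of f_s is O(N^a M^b), with
b = 1/p and a = max(1/2, 1 - 1/p) (sum_Lnorm_test_fun); for p = oo the trivial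
bound gives a = 1 and b = 0.

The restriction inequality would thus give m^n = O(m^(d a + n b)) for all m. For
k > 0 and p > 2n/(n+k) one has d a + n b < n, which is absurd for large m
(restriction_growth_absurd). For k = 0 there is nothing to test: at a point of E
where the first coordinate is maximal, the differential of a chart misses a
direction, so that a nonempty compact submanifold of R^n never has dimension n
(submanifold_dim_neq). *)

(** * Random signs *)

Section signs.
Variables (R : realType) (N : nat).
Implicit Types (s : {ffun 'I_N -> bool}) (a : 'I_N -> R).

Definition signed_sum s a : R := \sum_(j < N) (-1) ^+ s j * a j.

Definition flip (j : 'I_N) s : {ffun 'I_N -> bool} :=
  [ffun i => if i == j then ~~ s i else s i].

Lemma flipK j : involutive (flip j).
Proof.
by move=> s; apply/ffunP => i; rewrite !ffunE; case: eqP => // _; rewrite negbK.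
Qed.

Lemma sum_flip j (F : {ffun 'I_N -> bool} -> R) :
  \sum_s F (flip j s) = \sum_s F s.
Proof.
by rewrite [RHS](reindex (flip j))//; exists (flip j) => s _; exact: flipK.
Qed.

Lemma signed_sum_flip j s a :
  signed_sum (flip j s) a = signed_sum s a - 2 * ((-1) ^+ s j * a j).
Proof.
rewrite /signed_sum (bigD1 j)//= [in RHS](bigD1 j)//= ffunE eqxx.
under eq_bigr => i /negPf ij do rewrite ffunE ij.
by case: (s j); rewrite /= ?expr0 ?expr1; ring.
Qed.

Lemma norm_signs s j : `|(-1) ^+ s j : R| = 1.
Proof. by rewrite normrX normrN1 expr1n. Qed.

(** Pairing s with the choice in which the j-th sign is flipped, the two sums
differ by twice their j-th term, whose modulus is thus at most the mean of
theirs. *)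
Lemma sum_norm_signed_sum_ge j a :
  2 ^+ N * `|a j| <= \sum_s `|signed_sum s a|.
Proof.
rewrite -(@ler_pM2l _ 2)//.
have -> : 2 * \sum_s `|signed_sum s a| =
    \sum_s (`|signed_sum s a| + `|signed_sum (flip j s) a|).
  rewrite big_split/= (sum_flip j (fun s => `|signed_sum s a|)).
  by rewrite mulrDl mul1r.
have -> : 2 * (2 ^+ N * `|a j|) = \sum_(s : {ffun 'I_N -> bool}) 2 * `|a j|.
  by rewrite sumr_const card_ffun card_bool card_ord -(mulr_natl (2 * `|a j|)) natrX; ring.
apply: ler_sum => s _; rewrite signed_sum_flip.
have -> : 2 * `|a j| = `|2 * ((-1) ^+ s j * a j)|.
  by rewrite !normrM norm_signs mul1r [`|2|]ger0_norm.
set x := signed_sum s a; set y := 2 * _.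
by apply: le_trans (ler_normB x (x - y)); rewrite opprB addrC subrK.
Qed.

(** Orthogonality of the signs: flipping the j-th sign cancels every cross term
that contains it. *)
Lemma sum_sqr_signed_sum a :
  \sum_s signed_sum s a ^+ 2 = 2 ^+ N * \sum_(j < N) a j ^+ 2.
Proof.
under eq_bigr => s _ do rewrite expr2 {1}/signed_sum mulr_suml.
rewrite exchange_big/= mulr_sumr; apply: eq_bigr => j _.
apply: (mulfI (_ : (2 : R) != 0)) => //.
transitivity (\sum_(s : {ffun 'I_N -> bool}) ((-1) ^+ s j * a j * signed_sum s a +
  (-1) ^+ (flip j s j) * a j * signed_sum (flip j s) a)).
  rewrite big_split/= (sum_flip j (fun s => (-1) ^+ s j * a j * signed_sum s a)).
  by rewrite mulrDl mul1r.
under eq_bigr => s _.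
  rewrite signed_sum_flip ffunE eqxx.
  have -> : (-1) ^+ (~~ s j) = - (-1) ^+ s j :> R.
    by case: (s j) => /=; rewrite ?expr0 ?expr1 ?opprK.
  have -> : (-1) ^+ s j * a j * signed_sum s a +
      - (-1) ^+ s j * a j * (signed_sum s a - 2 * ((-1) ^+ s j * a j)) =
      ((-1) ^+ s j) ^+ 2 * (2 * a j ^+ 2) by ring.
  rewrite sqrr_sign mul1r; over.
by rewrite sumr_const card_ffun card_bool card_ord -(mulr_natl (2 * a j ^+ 2)) natrX; ring.
Qed.

Lemma norm_signed_sum_le s a (M : R) : (forall j, `|a j| <= M) ->
  `|signed_sum s a| <= N%:R * M.
Proof.
move=> aM; apply: le_trans (ler_norm_sum _ _ _) _.
apply: le_trans (_ : \sum_(j < N) M <= _).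
  by apply: ler_sum => j _; rewrite normrM norm_signs mul1r.
by rewrite sumr_const card_ord mulr_natl.
Qed.

End signs.

(** * Positivity of Gram determinants *)

Section gram.
Variables (R : realType) (d n : nat).
Implicit Types (J : 'M[R]_(d, n)).

Lemma row_normsq_ge0 m (v : 'rV[R]_m) : 0 <= (v *m v^T) 0 0.
Proof.
by rewrite mxE sumr_ge0// => i _; rewrite mxE -expr2 sqr_ge0.
Qed.

Lemma row_normsq_eq0 m (v : 'rV[R]_m) : (v *m v^T) 0 0 = 0 -> v = 0.
Proof.
rewrite mxE => /eqP; rewrite psumr_eq0; last first.
  by move=> i _; rewrite mxE -expr2 sqr_ge0.
move=> /allP v0; apply/rowP => i; rewrite mxE.
have := v0 i (mem_index_enum i); rewrite implyTb mxE -expr2 sqrf_eq0.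
by move=> /eqP.
Qed.

(** The polynomial det(X + J J^T) is monic, and it has no nonnegative root since
J J^T is positive definite; hence it is still positive at 0. *)
Lemma det_gram_gt0 J : row_free J -> 0 < \det (J *m J^T).
Proof.
move=> freeJ; set G := J *m J^T; set p := char_poly (- G).
have p_nz x : 0 <= x -> p.[x] != 0.
  move=> x0; apply/negP => /eqP px0.
  have /eigenvalueP[v vG v0] : eigenvalue (- G) x.
    by rewrite eigenvalue_root_char; apply/eqP.
  have vJ : (v *m J) *m (v *m J)^T = - (x *: (v *m v^T)).
    by rewrite trmx_mul scalemxAl -vG mulmxN mulNmx opprK /G !mulmxA.
  have vJ0 : v *m J = 0.
    apply: row_normsq_eq0; apply/eqP; rewrite eq_le row_normsq_ge0 andbT.
    by rewrite vJ mxE oppr_le0 mxE mulr_ge0// row_normsq_ge0.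
  move/eqP: v0; apply; apply/eqP.
  by rewrite -(mulmx_free_eq0 v freeJ) vJ0.
have -> : \det G = p.[0].
  rewrite /p /char_poly -horner_evalE -det_map_mx; congr (\det _).
  apply/matrixP => i j; rewrite !mxE /= !horner_evalE.
  rewrite hornerD hornerN hornerC hornerMn hornerX.
  by rewrite mul0rn add0r opprK.
rewrite lt_neqAle eq_sym p_nz//=; rewrite leNgt; apply/negP => p0.
have lp : 0 < lead_coef p by rewrite (monicP (char_poly_monic _)).
have [M HM] := poly_pinfty_gt_lc lp.
pose b := Num.max M 0.
have b0 : 0 <= b by rewrite le_max lexx orbT.
have pb : 0 < p.[b] by rewrite (lt_le_trans lp)// HM// le_max lexx.
have [|x] := @polyrcf.poly_ivt _ p 0 b b0; first by rewrite mulr_le0_ge0// ltW.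
by rewrite in_itv/= => /andP[x0 _] /eqP; apply/eqP/p_nz.
Qed.

End gram.

(** * Lebesgue measure on row vectors *)

Section consrV_coords.
Variable R : realType.

Lemma consrV0 n (x : measurableTypeR R) (v : 'rV[R]_n) : consrV (x, v) ord0 ord0 = x.
Proof.
rewrite /consrV/= (_ : ord0 = lshift n (ord0 : 'I_1)); last exact/val_inj.
by rewrite (@row_mxEl _ 1 1) mxE eqxx.
Qed.

Lemma consrVS n (x : measurableTypeR R) (v : 'rV[R]_n) (i : 'I_n) :
  consrV (x, v) ord0 (lift ord0 i) = v ord0 i.
Proof.
rewrite /consrV/= (_ : lift ord0 i = rshift 1 i); last exact/val_inj.
by rewrite (@row_mxEr _ 1 1).
Qed.

Definition box n (A : 'I_n -> set R) : set 'rV[R]_n :=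
  [set v | forall i, A i (v ord0 i)].

Lemma measurable_rV_coord n (i : 'I_n) :
  measurable_fun [set: 'rV[R]_n] (fun v => v ord0 i : measurableTypeR R).
Proof.
move=> _ C mC; rewrite setTI; apply: sub_sigma_algebra.
rewrite -bigcup_seq/=; exists i; first by rewrite /= mem_index_enum.
by exists C => //; rewrite setTI.
Qed.

Lemma measurable_box n (A : 'I_n -> set (measurableTypeR R)) :
  (forall i, measurable (A i)) -> measurable (box A).
Proof.
move=> mA.
have -> : box A = \big[setI/setT]_(i < n) ((fun v : 'rV[R]_n => v ord0 i) @^-1` (A i)).
  rewrite -bigcap_seq; apply/seteqP; split=> v /=.
    by move=> Av i _; exact: Av.
  by move=> Av i; apply: Av; rewrite /= mem_index_enum.
apply: bigsetI_measurable => i _.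
rewrite -[X in measurable X]setTI.
exact: measurable_rV_coord.
Qed.

Lemma preimage_consrV_box n (A : 'I_n.+1 -> set R) :
  @consrV R n @^-1` box A = A ord0 `*` box (fun i => A (lift ord0 i)).
Proof.
apply/seteqP; split=> -[x v] /=.
  move=> Av; split => [|i]; first by have := Av ord0; rewrite consrV0.
  by have := Av (lift ord0 i); rewrite consrVS.
move=> [Ax Av] i; have [j ->|->] := unliftP ord0 i.
  by rewrite consrVS; exact: Av.
by rewrite consrV0.
Qed.

Lemma lebesgue_rV_box n (A : 'I_n -> set (measurableTypeR R)) :
  (forall i, measurable (A i)) ->
  (lebesgue_rV R n (box A) = \prod_(i < n) lebesgue_measure (A i))%E.
Proof.
elim: n A => [|n IH] A mA.
  rewrite big_ord0 /= diracE mem_set//.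
  by case.
rewrite big_ord_recl /= /lebesgue_consrV /pushforward preimage_consrV_box.
rewrite product_measure2E//; first by rewrite IH.
exact: measurable_box.
Qed.

Lemma sigma_finite_lebesgue_rV n : sigma_finite [set: 'rV[R]_n] (lebesgue_rV R n).
Proof.
exists (fun k : nat => box (fun _ : 'I_n => [set` `[- (k%:R : R), k%:R]])).
  apply/esym; rewrite -subTset => v _.
  exists (\sum_(i < n) (Num.truncn `|v ord0 i|).+1)%N => // i /=.
  rewrite in_itv/= -ler_norml (le_trans (ltW (truncnS_gt _)))//.
  by rewrite ler_nat (bigD1 i)//= leq_addr.
move=> k; split; first by apply: measurable_box => i; exact: measurable_itv.
rewrite lebesgue_rV_box//.
set P := (X in (X < _)%E).
suff /andP[_ ->] : (0 <= P)%E && (P < +oo)%E by [].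
apply: (@big_ind _ (fun x : \bar R => (0 <= x)%E && (x < +oo)%E)).
- by rewrite lee01 ltry.
- move=> x y /andP[x0 xoo] /andP[y0 yoo]; rewrite mule_ge0//=.
  by rewrite lte_mul_pinfty// ge0_fin_numE.
- move=> i _; rewrite measure_ge0 lebesgue_measure_itv/=; case: ifP => // _.
  by rewrite -EFinB ltry.
Qed.

End consrV_coords.

Section sigma_finite_pack.
Context d (T : measurableType d) (R : realType).
Variable mu : {measure set T -> \bar R}.

(** Fubini's theorem expects the sigma-finiteness of a measure to be part of its
structure, whereas lebesgue_rV is known only as a measure. *)
Lemma sigma_finite_pack : sigma_finite setT mu ->
  exists nu : {sigma_finite_measure set T -> \bar R}, nu = mu :> {measure set T -> \bar R}.
Proof.
case: mu => f c h.
pose cf := Measure_isSigmaFinite.Build _ _ _ (Measure.Pack c) h.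
pose m' : {sigma_finite_measure set T -> \bar R} := HB.pack f c cf.
exists m'.
reflexivity.
Qed.

End sigma_finite_pack.

Section integral_rV.
Variable R : realType.
Local Notation leb := (@lebesgue_measure R).

(** Tonelli's theorem for the recursive definition of Lebesgue measure. That
definition uses the product measure built from horizontal sections, Tonelli's
theorem the one built from vertical sections; they agree on rectangles. *)
Lemma integral_lebesgue_rVS n (f : 'rV[R]_n.+1 -> \bar R) :
  measurable_fun [set: _] f -> (forall v, 0 <= f v)%E ->
  (\int[lebesgue_rV R n.+1]_v f v =
   \int[lebesgue_rV R n]_v \int[leb]_x f (consrV (x, v)))%E.
Proof.
move=> mf f0.
have [nu nuE] := sigma_finite_pack (@sigma_finite_lebesgue_rV R n).
rewrite /= -nuE.
have mc := @measurable_consrV R n.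
have -> : (\int[lebesgue_consrV nu]_v f v =
    \int[leb \x^ nu]_z (f \o @consrV R n) z)%E.
  rewrite -[RHS](@ge0_integral_pushforward _ _ _ _ _ _ mc (leb \x^ nu)%E setT f)//.
have mfc : measurable_fun setT (f \o @consrV R n) by exact: measurableT_comp.
rewrite (eq_measure_integral (leb \x nu)%E).
  by rewrite fubini_tonelli2// => z; exact: f0.
move=> A mA _; apply/esym; apply: product_measure_unique => // B C mB mC.
exact: product_measure2E.
Qed.

Lemma integral_rV_prod n (g : measurableTypeR R -> R) (c : R) :
  measurable_fun setT g -> (forall x, 0 <= g x) ->
  (\int[leb]_x (g x)%:E = c%:E)%E ->
  (\int[lebesgue_rV R n]_v (\prod_(i < n) g (v ord0 i))%:E = (c ^+ n)%:E)%E.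
Proof.
move=> mg g0 gc.
have mp m : measurable_fun [set: 'rV[R]_m] (fun v => \prod_(i < m) g (v ord0 i)).
  apply: measurable_prod => i _.
  by apply: (measurableT_comp mg); exact: measurable_rV_coord.
have p0 m (v : 'rV[R]_m) : 0 <= \prod_(i < m) g (v ord0 i) by exact: prodr_ge0.
elim: n => [|n IH].
  rewrite /= integral_dirac//; last by apply/measurable_EFinP; exact: mp.
  by rewrite diracE mem_set// mul1e big_ord0 expr0.
rewrite integral_lebesgue_rVS//; last 2 first.
- by apply/measurable_EFinP; exact: mp.
- by move=> v; rewrite lee_fin.
under eq_integral => v _.
  have -> : (\int[leb]_x (\prod_(i < n.+1) g (consrV (x, v) ord0 i))%:E =
     c%:E * (\prod_(i < n) g (v ord0 i))%:E)%E.
    rewrite -gc -ge0_integralZr ?lee_fin//.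
    - apply: eq_integral => x _; rewrite -EFinM big_ord_recl consrV0.
      by under eq_bigr do rewrite consrVS.
    - by apply/measurable_EFinP; exact: mg.
    - by move=> x _; rewrite lee_fin.
  over.
rewrite ge0_integralZl//=.
- by rewrite IH -EFinM exprS.
- by apply/measurable_EFinP; exact: mp.
- by move=> v _; rewrite lee_fin; exact: p0.
- by rewrite -gc; apply: integral_ge0 => x _; rewrite lee_fin.
Qed.
End integral_rV.

(** * Sup norm and Borel sets of row vectors *)

Section topology_rV.
Variables (R : realType).

Lemma rV_norm_leP n (v : 'rV[R]_n) (e : R) : 0 <= e ->
  `|v| <= e <-> forall i, `|v ord0 i| <= e.
Proof.
move=> e0; rewrite [`|v|]mx_normrE; split.
  move=> /bigmax_leP[_ H] i; exact: (H (ord0, i) isT).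
by move=> H; apply/bigmax_leP; split => // -[i j] _ /=; rewrite ord1.
Qed.

Lemma rV_norm_ltP n (v : 'rV[R]_n) (e : R) : 0 < e ->
  `|v| < e <-> forall i, `|v ord0 i| < e.
Proof.
move=> e0; rewrite [`|v|]mx_normrE; split.
  move=> /bigmax_ltP[_ H] i; exact: (H (ord0, i) isT).
by move=> H; apply/bigmax_ltP; split => // -[i j] _ /=; rewrite ord1.
Qed.

Lemma rV_coord_le n (v : 'rV[R]_n) i : `|v ord0 i| <= `|v|.
Proof. by have /rV_norm_leP := lexx `|v|; exact. Qed.

(** An open set is the union of the cubes with rational centre and radius
1/(k+1) that it contains. *)
Lemma open_measurable_rV n (U : set 'rV[R]_n) : open U -> measurable U.
Proof.
move=> oU.
pose ratbox (qk : 'rV[rat]_n * nat) : set 'rV[R]_n :=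
  box (fun i => [set` `]ratr (qk.1 ord0 i) - qk.2.+1%:R^-1,
                     ratr (qk.1 ord0 i) + qk.2.+1%:R^-1[]).
have mbox qk : measurable (ratbox qk).
  by apply: measurable_box => i; exact: measurable_itv.
pose F qk := if `[< ratbox qk `<=` U >] then ratbox qk else set0.
have -> : U = \bigcup_qk F qk.
  apply/seteqP; split=> [x Ux|x [qk _]]; last first.
    by rewrite /F; case: asboolP => // sub /sub.
  have /nbhs_ballP[e /= e0 xeU] : nbhs x U by exact: open_nbhs_nbhs.
  (* A cube of radius 1/(k+1) that contains x has diameter at most 2/(k+1) < e. *)
  pose k := Num.truncn (2 / e).
  have ke : k.+1%:R^-1 * 2 < e.
    by rewrite mulrC ltr_pdivrMr// -ltr_pdivrMl// mulrC truncnS_gt.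
  have k0 : 0 < k.+1%:R^-1 :> R by rewrite invr_gt0.
  have /choice[q xq] : forall i : 'I_n, exists q : rat,
      ratr q \in `]x ord0 i - k.+1%:R^-1, x ord0 i + k.+1%:R^-1[.
    move=> i; have [|q xq] := @rat_in_itvoo R (x ord0 i - k.+1%:R^-1) (x ord0 i + k.+1%:R^-1).
      by rewrite ltrBlDr -addrA ltrDl addr_gt0.
    by exists q.
  exists (\row_i q i, k) => //; rewrite /F asboolT.
    move=> i /=; have := xq i; rewrite mxE !in_itv/=.
    by move: (k.+1%:R^-1) (ratr _) => r z /andP[? ?]; apply/andP; split; lra.
  move=> y By; apply: xeU; rewrite -ball_normE /ball_/=.
  apply: le_lt_trans ke; apply/rV_norm_leP; first by rewrite mulr_ge0// ltW.
  move=> i; have := xq i; have := By i; rewrite /= !mxE !in_itv/= ler_norml.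
  move: (k.+1%:R^-1) (ratr _) => r z.
  by move=> /andP[? ?] /andP[? ?]; apply/andP; split; lra.
apply: countable_bigcupT_measurable => // qk; rewrite /F.
by case: asboolP => // _; exact: measurable0.
Qed.

Lemma compact_measurable_rV n (E : set 'rV[R]_n) : compact E -> measurable E.
Proof.
move=> cE; rewrite -[E]setCK; apply: measurableC; apply: open_measurable_rV.
by apply: closed_openC; apply: compact_closed => //; exact: norm_hausdorff.
Qed.

Lemma continuous_measurable_rV n (f : 'rV[R]_n -> R) :
  continuous f -> measurable_fun [set: 'rV[R]_n] (f : _ -> measurableTypeR R).
Proof.
move=> /continuousP cf; apply: (measurability _ (RGenOpens.measurableE R)).
move=> _ [_ [a [b ->] <-]]; rewrite setTI; apply: open_measurable_rV.
exact/cf/interval_open.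
Qed.

End topology_rV.

(** * Gaussian integrals *)

Import HBNNSimple.

Section lower_integral.
Context d (T : measurableType d) (R : realType).
Variable mu : {measure set T -> \bar R}.
Local Open Scope ereal_scope.

(** The integral of a nonnegative function is a supremum over simple functions
below it, so that it is monotone without any measurability assumption. This
spares the measurability of the transform and of volume densities. *)
Lemma le_lower_integral (D1 D2 : set T) (f1 f2 : T -> \bar R) :
  D1 `<=` D2 -> (forall x, D1 x -> 0 <= f1 x) -> (forall x, D2 x -> 0 <= f2 x) ->
  (forall x, D1 x -> f1 x <= f2 x) ->
  \int[mu]_(x in D1) f1 x <= \int[mu]_(x in D2) f2 x.
Proof.
move=> D12 f10 f20 f12; rewrite !ge0_integralE//.
apply: ereal_sup_le => _ [h hf1 <-].
exists h => // x.
apply: le_trans (hf1 x) _; rewrite /patch.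
case: ifPn => [|_].
  by rewrite inE => D1x; rewrite mem_set ?f12//; exact: D12.
by case: ifPn => //; rewrite inE; exact: f20.
Qed.

End lower_integral.

Section gaussian.
Variables (R : realType).
Local Notation leb := (@lebesgue_measure R).

(** This is the total mass of the normal law of variance 1/(2t). *)
Lemma integral_gaussian1 (t : R) : 0 < t ->
  (\int[leb]_x (expR (- (t * x ^+ 2)))%:E = (Num.sqrt (pi / t))%:E)%E.
Proof.
move=> t0; pose s := Num.sqrt ((2 * t)^-1).
have ss : s ^+ 2 = (2 * t)^-1 by rewrite sqr_sqrtr// invr_ge0 mulr_ge0// ltW.
have s0 : s != 0 by rewrite gt_eqF// sqrtr_gt0 invr_gt0 mulr_gt0.
have sp : s ^+ 2 * pi *+ 2 = pi / t by rewrite ss; field; rewrite gt_eqF.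
have := @integral_normal_pdf R 0 s.
under eq_integral => x _.
  rewrite normal_pdfE// /normal_fun subr0 ss.
  have -> : - x ^+ 2 / ((2 * t)^-1 *+ 2) = - (t * x ^+ 2).
    by field; rewrite gt_eqF.
  rewrite EFinM; over.
rewrite ge0_integralZl_EFin//.
- rewrite /normal_peak sp => /eqP.
  have p0 : 0 < Num.sqrt (pi / t) by rewrite sqrtr_gt0 divr_gt0// pi_gt0.
  by rewrite (eqe_pdivrMl _ _ (lt0r_neq0 p0)) mule1 => /eqP.
- apply/measurable_EFinP; apply: measurableT_comp => //.
  by apply: measurableT_comp => //; apply: measurable_funM.
- exact: normal_peak_ge0.
Qed.

Definition gaussian n (t : R) (x : 'rV[R]_n) : R := expR (- (t * dotp x x)).

Lemma gaussian_prod n t (x : 'rV[R]_n) :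
  gaussian t x = \prod_(i < n) expR (- (t * x ord0 i ^+ 2)).
Proof. by rewrite /gaussian /dotp mulr_sumr -sumrN expR_sum. Qed.

Lemma gaussian_ge0 n t (x : 'rV[R]_n) : 0 <= gaussian t x.
Proof. exact: expR_ge0. Qed.

Lemma dotp_ge0 n (x : 'rV[R]_n) : 0 <= dotp x x.
Proof. by apply: sumr_ge0 => i _; rewrite -expr2 sqr_ge0. Qed.

Lemma gaussianX n t (x : 'rV[R]_n) p : gaussian t x `^ p = gaussian (p * t) x.
Proof.
by rewrite /gaussian -expRM; congr expR; ring.
Qed.

(** Integral of the Gaussian over R^n. *)
Definition gaussian_mass n (t : R) : R := Num.sqrt (pi / t) ^+ n.

Lemma gaussian_mass_gt0 n t : 0 < t -> 0 < gaussian_mass n t.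
Proof. by move=> t0; rewrite exprn_gt0// sqrtr_gt0 divr_gt0// pi_gt0. Qed.

Lemma gaussian_massM n t a : 0 < t -> 0 < a ->
  gaussian_mass n (a * t) = Num.sqrt a^-1 ^+ n * gaussian_mass n t.
Proof.
move=> t0 a0; rewrite /gaussian_mass -exprMn -sqrtrM ?invr_ge0 ?ltW//.
by congr (Num.sqrt _ ^+ n); field; rewrite !gt_eqF.
Qed.

Lemma integral_gaussian n (t : R) : 0 < t ->
  (\int[lebesgue_rV R n]_x (gaussian t x)%:E = (gaussian_mass n t)%:E)%E.
Proof.
move=> t0; under eq_integral do rewrite gaussian_prod.
rewrite (@integral_rV_prod R n (fun y => expR (- (t * y ^+ 2))) (Num.sqrt (pi / t)))//.
- by apply: measurableT_comp => //; apply: measurableT_comp => //; apply: measurable_funM.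
- exact: integral_gaussian1.
Qed.

Lemma measurable_dotp n (y : 'rV[R]_n) :
  measurable_fun [set: 'rV[R]_n] (fun x => dotp x y : measurableTypeR R).
Proof.
apply: measurable_sum => i; apply: measurable_funM => //.
exact: measurable_rV_coord.
Qed.

Lemma measurable_gaussian n t :
  measurable_fun [set: 'rV[R]_n] (fun x => gaussian t x : measurableTypeR R).
Proof.
have md : measurable_fun [set: 'rV[R]_n] (fun x => dotp x x : measurableTypeR R).
  by apply: measurable_sum => i; apply: measurable_funM; exact: measurable_rV_coord.
apply: (measurableT_comp (@measurable_expR R)).
by apply: (measurableT_comp (@oppr_measurable R setT)); apply: measurable_funM.
Qed.

Lemma integrable_gaussian n t : 0 < t ->
  (lebesgue_rV R n).-integrable [set: 'rV[R]_n] (fun x => (gaussian t x)%:E).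
Proof.
move=> t0; apply/integrableP; split.
  by apply/measurable_EFinP; exact: measurable_gaussian.
under eq_integral do rewrite /= ger0_norm ?gaussian_ge0//.
by rewrite integral_gaussian// ltry.
Qed.

End gaussian.

(** * The cosine transform of a Gaussian *)

Section kernel.
Variables (R : realType).

Lemma cos_lipschitz (a b : R) : `|cos a - cos b| <= `|a - b|.
Proof.
wlog ab : a b / a <= b.
  by move=> H; have [/H//|/ltW/H] := leP a b; rewrite distrC (distrC b).
have [|c _ cE] := @MVT_segment R cos (fun x => - sin x) a b ab
  (fun x _ => is_derive_cos x).
  by apply: continuous_subspaceT => x; exact: continuous_cos.
rewrite distrC cE normrM normrN distrC ler_piMl//.
exact: sin_max.
Qed.

Lemma dotpBr n (x y z : 'rV[R]_n) : dotp x (y - z) = dotp x y - dotp x z.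
Proof. by rewrite /dotp -sumrB; apply: eq_bigr => i _; rewrite !mxE mulrBr. Qed.

Lemma dotp0r n (x : 'rV[R]_n) : dotp x 0 = 0.
Proof. by rewrite /dotp big1// => i _; rewrite mxE mulr0. Qed.

Lemma norm_dotp_le n (x y : 'rV[R]_n) : `|dotp x y| <= (\sum_i `|x ord0 i|) * `|y|.
Proof.
rewrite /dotp mulr_suml; apply: le_trans (ler_norm_sum _ _ _) _.
by apply: ler_sum => i _; rewrite normrM ler_wpM2l// rV_coord_le.
Qed.

Lemma sqr_coord_le_dotp n (x : 'rV[R]_n) i : x ord0 i ^+ 2 <= dotp x x.
Proof.
rewrite /dotp (bigD1 i)//= -expr2 lerDl sumr_ge0// => j _.
by rewrite -expr2 sqr_ge0.
Qed.

(** With y = sqrt t |x_i|, this follows from y <= 1 + y^2/2 <= exp(t |x|^2/2):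
half of the Gaussian decay absorbs a linear factor. *)
Lemma norm_coord_gaussian_le n (t : R) (x : 'rV[R]_n) i : 0 < t ->
  `|x ord0 i| * gaussian t x <= (Num.sqrt t)^-1 * gaussian (2^-1 * t) x.
Proof.
move=> t0.
have -> : gaussian t x = expR (- (2^-1 * t * dotp x x)) * gaussian (2^-1 * t) x.
  by rewrite /gaussian -expRD; congr expR; field.
rewrite mulrA ler_wpM2r ?gaussian_ge0// expRN ler_pdivrMr ?expR_gt0//.
rewrite mulrC ler_pdivlMr ?sqrtr_gt0//.
set y := `|x ord0 i| * Num.sqrt t.
have y2 : y ^+ 2 <= t * dotp x x.
  rewrite exprMn (sqr_sqrtr (ltW t0)) [leLHS]mulrC real_normK ?num_real//.
  rewrite (ler_wpM2l (ltW t0))//.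
  exact: sqr_coord_le_dotp.
apply: le_trans (_ : 1 + 2^-1 * t * dotp x x <= _); last exact: expR_ge1Dx.
have := sqr_ge0 (y - 1); rewrite sqrrB1 -mulrA; lra.
Qed.

(** Fourier transform of the Gaussian. It is never computed: its value at the
origin and a Lipschitz bound are enough. *)
Definition cos_kernel n (t : R) (eta : 'rV[R]_n) : R :=
  \int[lebesgue_rV R n]_x (gaussian t x * cos (2 * pi * dotp x eta)).

Lemma integrable_gaussian_cos n t (eta : 'rV[R]_n) : 0 < t ->
  (lebesgue_rV R n).-integrable [set: 'rV[R]_n]
    (fun x => (gaussian t x * cos (2 * pi * dotp x eta))%:E).
Proof.
move=> t0; apply: le_integrable (integrable_gaussian n t0) => //.
- apply/measurable_EFinP; apply: measurable_funM; first exact: measurable_gaussian.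
  apply: measurableT_comp; first exact: continuous_measurable_fun (@continuous_cos R).
  by apply: measurable_funM => //; exact: measurable_dotp.
- move=> x _; rewrite /= lee_fin normrM ler_piMr//.
  exact: cos_max.
Qed.

Lemma cos_kernel0 n t : 0 < t -> cos_kernel t (0 : 'rV[R]_n) = gaussian_mass n t.
Proof.
move=> t0; rewrite /cos_kernel /Rintegral.
under eq_integral do rewrite dotp0r mulr0 cos0 mulr1.
by rewrite integral_gaussian.
Qed.

Definition kernel_lip n (t : R) : R :=
  2 * pi * (n%:R * (Num.sqrt t)^-1) * gaussian_mass n (2^-1 * t).

(** The cosine being 1-Lipschitz, the increments are controlled by the first
absolute moment of the Gaussian. *)
Lemma cos_kernel_lipschitz n t (eta eta' : 'rV[R]_n) : 0 < t ->
  `|cos_kernel t eta - cos_kernel t eta'| <= kernel_lip n t * `|eta - eta'|.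
Proof.
move=> t0; have t20 : 0 < 2^-1 * t by rewrite mulr_gt0.
have ic (e : 'rV[R]_n) := integrable_gaussian_cos e t0.
have iB : (lebesgue_rV R n).-integrable [set: 'rV[R]_n] (EFin \o (fun x =>
    gaussian t x * cos (2 * pi * dotp x eta) -
    gaussian t x * cos (2 * pi * dotp x eta'))).
  rewrite [X in _.-integrable _ X](_ : _ = (fun x =>
    (gaussian t x * cos (2 * pi * dotp x eta))%:E -
    (gaussian t x * cos (2 * pi * dotp x eta'))%:E)%E); last by apply/funext => x; rewrite /= EFinB.
  exact: integrableB.
rewrite /cos_kernel -RintegralB//; [|exact: ic..].
apply: le_trans (le_normr_Rintegral _ iB) _ => //.
pose c := 2 * pi * `|eta - eta'| * (n%:R * (Num.sqrt t)^-1).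
apply: le_trans (_ : \int[lebesgue_rV R n]_x (c * gaussian (2^-1 * t) x) <= _).
  apply: le_Rintegral => //.
  - exact: integrable_norm.
  - rewrite [X in _.-integrable _ X](_ : _ = (fun x => c%:E * (gaussian (2^-1 * t) x)%:E)%E)//.
    by apply: integrableZl => //; exact: integrable_gaussian.
  move=> x _; rewrite -mulrBr normrM ger0_norm ?gaussian_ge0//.
  apply: le_trans (_ : gaussian t x * (2 * pi * ((\sum_i `|x ord0 i|) * `|eta - eta'|)) <= _).
    rewrite ler_wpM2l ?gaussian_ge0//; apply: le_trans (cos_lipschitz _ _) _.
    rewrite -mulrBr -dotpBr normrM ger0_norm ?mulr_ge0 ?pi_ge0//.
    by rewrite ler_wpM2l ?mulr_ge0 ?pi_ge0// norm_dotp_le.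
  have -> : gaussian t x * (2 * pi * ((\sum_i `|x ord0 i|) * `|eta - eta'|)) =
     2 * pi * `|eta - eta'| * \sum_i (`|x ord0 i| * gaussian t x).
    by rewrite -mulr_suml; ring.
  rewrite /c -!mulrA; do 3 (rewrite ler_wpM2l ?pi_ge0//).
  apply: le_trans (_ : \sum_(i < n) (Num.sqrt t)^-1 * gaussian (2^-1 * t) x <= _).
    by apply: ler_sum => i _; exact: norm_coord_gaussian_le.
  by rewrite sumr_const card_ord mulr_natl.
rewrite RintegralZl//; last exact: integrable_gaussian.
rewrite /Rintegral integral_gaussian//= /kernel_lip /c; lra.
Qed.

Lemma kernel_lip_ge0 n t : 0 < t -> 0 <= kernel_lip n t.
Proof.
move=> t0; rewrite !mulr_ge0 ?pi_ge0// ?invr_ge0 ?sqrtr_ge0//.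
by rewrite ltW// gaussian_mass_gt0// mulr_gt0.
Qed.

Lemma continuous_cos_kernel n t (xi0 : 'rV[R]_n) : 0 < t ->
  continuous (fun xi : 'rV[R]_n => cos_kernel t (xi0 - xi)).
Proof.
move=> t0 x.
have k1 : 0 < kernel_lip n t + 1 by rewrite ltr_wpDl// kernel_lip_ge0.
apply/(@cvgrPdist_lt _ _ _ (nbhs (x : 'rV[R]_n))) => e e0; apply/nbhs_ballP.
exists ((kernel_lip n t + 1)^-1 * e) => /=; first by rewrite mulr_gt0// invr_gt0.
move=> y; rewrite -ball_normE /ball_/= ltr_pdivlMl// => xy.
apply: le_lt_trans xy; apply: le_trans (cos_kernel_lipschitz _ _ t0) _.
have -> : xi0 - x - (xi0 - y) = - (x - y).
  by apply/matrixP => i j; rewrite !mxE; ring.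
by rewrite normrN ler_wpM2r// lerDl.
Qed.

Lemma measurable_cos_kernel n t (xi0 : 'rV[R]_n) : 0 < t ->
  measurable_fun [set: 'rV[R]_n] (fun xi => cos_kernel t (xi0 - xi) : measurableTypeR R).
Proof.
by move=> t0; apply: continuous_measurable_rV; exact: continuous_cos_kernel.
Qed.

(** The kernel is the mass of the Gaussian at the origin, and its Lipschitz
constant is this mass times a multiple of the width 1/sqrt t. *)
Lemma cos_kernel_ge n t (eta : 'rV[R]_n) : 0 < t ->
  4 * pi * n%:R * Num.sqrt 2 ^+ n * `|eta| <= Num.sqrt t ->
  gaussian_mass n t / 2 <= cos_kernel t eta.
Proof.
move=> t0 etat.
have m0 := gaussian_mass_gt0 n t0.
have := cos_kernel_lipschitz eta 0 t0; rewrite cos_kernel0// subr0 => H.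
have {H}: gaussian_mass n t - kernel_lip n t * `|eta| <= cos_kernel t eta.
  by rewrite lerBlDr addrC -lerBlDr; apply: le_trans H; rewrite -normrN opprB ler_norm.
apply: le_trans; rewrite lerBrDr -lerBrDl.
have -> : gaussian_mass n t - gaussian_mass n t / 2 = gaussian_mass n t / 2 by field.
rewrite /kernel_lip gaussian_massM// invrK.
have st : 0 < Num.sqrt t by rewrite sqrtr_gt0.
set s := Num.sqrt t in etat st *.
have -> : 2 * pi * (n%:R / s) * (Num.sqrt 2 ^+ n * gaussian_mass n t) * `|eta| =
  gaussian_mass n t / 2 * (4 * pi * n%:R * Num.sqrt 2 ^+ n * `|eta| / s).
  by field; rewrite gt_eqF.
by rewrite ler_piMr ?divr_ge0 ?(ltW m0)// ler_pdivrMr// mul1r.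
Qed.

End kernel.

(** * Schwartz functions built on a Gaussian *)

Section schwartz_class.
Variables (R : realType) (n : nat).
Implicit Types (f g : 'rV[R]_n -> R) (x y : 'rV[R]_n).

Definition has_partials f (F : 'I_n -> 'rV[R]_n -> R) :=
  forall x, differentiable f x /\ forall i, 'D_(rV_basis R i) f x = F i x.

Lemma has_partials_cst (c : R) : has_partials (fun=> c) (fun _ _ => 0).
Proof. by move=> x; split=> [|i]; [exact: differentiable_cst|exact: derive_cst]. Qed.

Lemma has_partials_coord (j : 'I_n) :
  has_partials (fun x => x ord0 j) (fun i _ => (i == j)%:R).
Proof.
move=> x; have dj := differentiable_coord x ord0 j; split => // i.
apply: cvg_lim => //; apply: cvg_near_cst; near=> e.
rewrite /= !mxE eqxx/= eq_sym addrK [_ *: _]mulrA mulVf ?mul1r//.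
by near: e; exact: nbhs_dnbhs_neq.
Unshelve. all: by end_near. Qed.

Lemma has_partialsD f g F G : has_partials f F -> has_partials g G ->
  has_partials (fun x => f x + g x) (fun i x => F i x + G i x).
Proof.
move=> hf hg x; have [df fF] := hf x; have [dg gG] := hg x; split.
  exact: differentiableD.
by move=> i; rewrite deriveD ?fF ?gG//; exact: diff_derivable.
Qed.

Lemma has_partialsM f g F G : has_partials f F -> has_partials g G ->
  has_partials (fun x => f x * g x) (fun i x => f x * G i x + g x * F i x).
Proof.
move=> hf hg x; have [df fF] := hf x; have [dg gG] := hg x; split.
  exact: differentiableM.
by move=> i; rewrite deriveM ?fF ?gG//; exact: diff_derivable.
Qed.

Lemma has_partials_comp (u u' : R -> R) f F :
  (forall y : R, is_derive y 1 u (u' y)) -> has_partials f F ->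
  has_partials (fun x => u (f x)) (fun i x => u' (f x) * F i x).
Proof.
move=> hu hf x; have [df fF] := hf x.
have du (y : R) : differentiable u y by apply/derivable1_diffP; exact: ex_derive.
have dc : differentiable (u \o f) x by exact: differentiable_comp.
split => // i; rewrite (deriveE _ dc) diff_comp//= diff1E//.
by rewrite -deriveE// fF derive1E derive_val [LHS]mulrC.
Qed.

Definition phase (y x : 'rV[R]_n) : R := 2 * pi * dotp x y.

Lemma has_partials_sum (I : Type) (r : seq I) (h : I -> 'rV[R]_n -> R) H :
  (forall k, has_partials (h k) (H k)) ->
  has_partials (fun x => \sum_(k <- r) h k x) (fun i x => \sum_(k <- r) H k i x).
Proof.
move=> hh; elim: r => [|k r IH].
  have := has_partials_cst 0; congr has_partials; first by apply/funext => x; rewrite big_nil.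
  by apply/funext => i; apply/funext => x; rewrite big_nil.
have := has_partialsD (hh k) IH; congr has_partials.
  by apply/funext => x; rewrite big_cons.
by apply/funext => i; apply/funext => x; rewrite big_cons.
Qed.

Lemma has_partials_phase y : has_partials (phase y) (fun i _ => 2 * pi * y ord0 i).
Proof.
have := has_partialsM (has_partials_cst (2 * pi)) (has_partials_sum (index_enum 'I_n)
  (fun k => has_partialsM (has_partials_coord k) (has_partials_cst (y ord0 k)))).
congr has_partials; apply/funext => i; apply/funext => x.
rewrite mulr0 addr0; congr (_ * _); rewrite (bigD1 i)//= eqxx mulr0 add0r mulr1.
by rewrite big1 ?addr0// => k; rewrite eq_sym => /negbTE ->; rewrite !mulr0 addr0.
Qed.

Lemma has_partials_gaussian t :
  has_partials (gaussian t) (fun i x => - (2 * t) * x ord0 i * gaussian t x).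
Proof.
have := has_partials_comp (@is_derive_expR R) (has_partialsM (has_partials_cst (- t))
  (has_partials_sum (index_enum 'I_n)
  (fun k => has_partialsM (has_partials_coord k) (has_partials_coord k)))).
rewrite (_ : (fun x : 'rV[R]_n => expR _) = gaussian t); last first.
  by apply/funext => x; rewrite /gaussian mulNr.
congr has_partials; apply/funext => i; apply/funext => x.
rewrite mulr0 addr0 [in LHS]mulrC mulNr /gaussian /dotp; congr (_ * _); last by rewrite mulNr.
rewrite (bigD1 i)//= eqxx big1 => [|k]; first by rewrite mulr1n; ring.
by rewrite eq_sym => /negbTE ->; rewrite !mulr0 addr0.
Qed.

(** An algebra of functions that contains the monomials and the exponentials of
x.y, and that is stable under partial derivatives; its members grow more slowly
than any Gaussian decays. Gaussian multiples of tame functions are Schwartz. *)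
Inductive tame : ('rV[R]_n -> R) -> Prop :=
| tame_cst (c : R) : tame (fun=> c)
| tame_coord (i : 'I_n) : tame (fun x => x ord0 i)
| tame_cos y : tame (fun x => cos (phase y x))
| tame_sin y : tame (fun x => sin (phase y x))
| tameD f g : tame f -> tame g -> tame (fun x => f x + g x)
| tameM f g : tame f -> tame g -> tame (fun x => f x * g x).

Lemma tame_sum (I : Type) (r : seq I) (h : I -> 'rV[R]_n -> R) :
  (forall k, tame (h k)) -> tame (fun x => \sum_(k <- r) h k x).
Proof.
move=> th; elim: r => [|k r IH].
  rewrite (_ : (fun _ => _) = fun=> 0); first exact: tame_cst.
  by apply/funext => x; rewrite big_nil.
rewrite (_ : (fun _ => _) = fun x => h k x + \sum_(k <- r) h k x).
  exact: tameD.
by apply/funext => x; rewrite big_cons.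
Qed.

Lemma tame_prod (I : Type) (r : seq I) (h : I -> 'rV[R]_n -> R) :
  (forall k, tame (h k)) -> tame (fun x => \prod_(k <- r) h k x).
Proof.
move=> th; elim: r => [|k r IH].
  rewrite (_ : (fun _ => _) = fun=> 1); first exact: tame_cst.
  by apply/funext => x; rewrite big_nil.
rewrite (_ : (fun _ => _) = fun x => h k x * \prod_(k <- r) h k x).
  exact: tameM.
by apply/funext => x; rewrite big_cons.
Qed.

Lemma tameX f m : tame f -> tame (fun x => f x ^+ m).
Proof.
move=> tf; elim: m => [|m IH]; first exact: tame_cst.
rewrite (_ : (fun _ => _) = fun x => f x * f x ^+ m); first exact: tameM.
by apply/funext => x; rewrite exprS.
Qed.

Lemma tame_monomial a : tame (@monomial R n a).
Proof. by apply: tame_prod => i; apply: tameX; exact: tame_coord. Qed.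

Lemma tame_partials f : tame f -> exists2 F, has_partials f F & forall i, tame (F i).
Proof.
elim=> {f} [c|j|y|y|f g _ [F hF tF] _ [G hG tG]|f g tf [F hF tF] tg [G hG tG]].
- by exists (fun _ _ => 0); [exact: has_partials_cst|move=> i; exact: tame_cst].
- by exists (fun i _ => (i == j)%:R); [exact: has_partials_coord|move=> i; exact: tame_cst].
- eexists; first exact: has_partials_comp (@is_derive_cos R) (has_partials_phase y).
  move=> i /=; rewrite (_ : (fun _ => _) = fun x => - (2 * pi * y ord0 i) * sin (phase y x)).
    by apply: tameM; [exact: tame_cst|exact: tame_sin].
  by apply/funext => x; ring.
- eexists; first exact: has_partials_comp (@is_derive_sin R) (has_partials_phase y).
  by move=> i /=; apply: tameM; [exact: tame_cos|exact: tame_cst].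
- by eexists; [exact: has_partialsD hF hG|move=> i; exact: tameD].
- eexists; [exact: has_partialsM hF hG|move=> i].
  by apply: tameD; exact: tameM.
Qed.

(** The bound for all e > 0 is what makes the induction pass through products:
each factor takes half of the exponent. *)
Lemma tame_subexp f (e : R) : tame f -> 0 < e ->
  exists C, forall x, `|f x| <= C * expR (e * dotp x x).
Proof.
move=> tf; elim: tf e => {f} [c|j|y|y|f g _ IHf _ IHg|f g _ IHf _ IHg] e e0.
- exists `|c| => x; rewrite ler_peMr// -expR0 ler_expR mulr_ge0 ?dotp_ge0//.
  exact: ltW.
- (* |y| <= 1 + y^2 <= (1 + 1/e) (1 + e y^2). *)
  exists (1 + e^-1) => x.
  have ee : 0 <= e^-1 by rewrite invr_ge0 ltW.
  apply: le_trans (_ : (1 + e^-1) * (1 + e * dotp x x) <= _); last first.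
    by rewrite ler_wpM2l ?addr_ge0// expR_ge1Dx.
  have d0 := dotp_ge0 x.
  apply: le_trans (_ : 1 + `|x ord0 j| ^+ 2 <= _).
    by have := sqr_ge0 (`|x ord0 j| - 1); rewrite sqrrB1; have := normr_ge0 (x ord0 j); lra.
  apply: le_trans (_ : 1 + dotp x x <= _).
    by rewrite lerD2l real_normK ?num_real// sqr_coord_le_dotp.
  have -> : (1 + e^-1) * (1 + e * dotp x x) = 1 + e * dotp x x + e^-1 + dotp x x.
    by field; rewrite gt_eqF.
  have : 0 <= e * dotp x x by rewrite mulr_ge0// ltW.
  lra.
- exists 1 => x; rewrite mul1r (le_trans (cos_max _))// -expR0 ler_expR.
  by rewrite mulr_ge0 ?dotp_ge0// ltW.
- exists 1 => x; rewrite mul1r (le_trans (sin_max _))// -expR0 ler_expR.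
  by rewrite mulr_ge0 ?dotp_ge0// ltW.
- have [C HC] := IHf e e0; have [D HD] := IHg e e0; exists (C + D) => x.
  by rewrite mulrDl (le_trans (ler_normD _ _))// lerD.
- have e20 : 0 < e / 2 by rewrite divr_gt0.
  have [C HC] := IHf _ e20; have [D HD] := IHg _ e20; exists (C * D) => x.
  have -> : e * dotp x x = e / 2 * dotp x x + e / 2 * dotp x x by field.
  by rewrite expRD mulrACA normrM ler_pM.
Qed.

Lemma tame_gaussian_bounded f t : 0 < t -> tame f ->
  exists C, forall x, `|f x * gaussian t x| <= C.
Proof.
move=> t0 tf; have [C HC] := tame_subexp tf t0; exists C => x.
rewrite normrM (ger0_norm (gaussian_ge0 _ _)) /gaussian expRN.
by rewrite ler_pdivrMr ?expR_gt0.
Qed.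

Lemma iter_partial_tame_gaussian f t (s : seq 'I_n) : tame f ->
  exists2 h, tame h & iter_partial s (fun x => f x * gaussian t x) =
                      fun x => h x * gaussian t x.
Proof.
move=> tf; elim: s => [|i s [h th IH]]; first by exists f.
have [H hH tH] := tame_partials th.
exists (fun x => h x * (- (2 * t) * x ord0 i) + H i x).
  apply: tameD => //; apply: tameM => //.
  by apply: tameM; [exact: tame_cst|exact: tame_coord].
rewrite /= IH; apply/funext => x.
have [_ ->] := has_partialsM hH (has_partials_gaussian t) x; ring.
Qed.

Lemma schwartz_tame_gaussian f t : 0 < t -> tame f ->
  real_schwartz (fun x => f x * gaussian t x).
Proof.
move=> t0 tf; split=> [s x _|a s].
  have [h th ->] := iter_partial_tame_gaussian t s tf.
  have [H hH _] := tame_partials th.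
  by have [] := has_partialsM hH (has_partials_gaussian t) x.
have [h th ->] := iter_partial_tame_gaussian t s tf.
have [C HC] := tame_gaussian_bounded t0 (tameM (tame_monomial a) th).
by exists C => x; rewrite mulrA.
Qed.

End schwartz_class.

(** * Exponential sums with random signs *)

Section test_functions.
Variables (R : realType) (n N : nat).
Variables (xi : 'I_N -> 'rV[R]_n) (t : R).
Hypothesis t0 : 0 < t.
Implicit Types (s : {ffun 'I_N -> bool}).

Definition cos_poly s (x : 'rV[R]_n) := signed_sum s (fun j => cos (phase (xi j) x)).
Definition sin_poly s (x : 'rV[R]_n) := signed_sum s (fun j => sin (phase (xi j) x)).

Definition test_fun s (x : 'rV[R]_n) : R[i] :=
  Complex (cos_poly s x * gaussian t x) (sin_poly s x * gaussian t x).

Lemma schwartz_test_fun s : schwartz (test_fun s).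
Proof.
split; apply: schwartz_tame_gaussian => //; apply: tame_sum => j.
  by apply: tameM; [exact: tame_cst|exact: tame_cos].
by apply: tameM; [exact: tame_cst|exact: tame_sin].
Qed.

(** Modulating by xi_j translates the transform by xi_j. The real part suffices
for a lower bound of the modulus. *)
Lemma Re_fourier_test_fun s (zeta : 'rV[R]_n) :
  complex.Re (fourier (test_fun s) zeta) =
  signed_sum s (fun j => cos_kernel t (xi j - zeta)).
Proof.
rewrite /fourier /Cintegral /= /Rintegral.
under eq_integral => x _.
  rewrite /re /=.
  have -> : cos (- (2 * pi * dotp x zeta)) * (cos_poly s x * gaussian t x) -
      sin (- (2 * pi * dotp x zeta)) * (sin_poly s x * gaussian t x) =
      \sum_(j < N) (-1) ^+ s j * (gaussian t x * cos (2 * pi * dotp x (xi j - zeta))).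
    rewrite cosN sinN mulNr opprK; under [RHS]eq_bigr do rewrite dotpBr mulrBr cosB.
    rewrite -!/(phase _ x); move: (phase zeta x) => th; rewrite /cos_poly /sin_poly /signed_sum.
    rewrite !mulr_suml !mulr_sumr -big_split/=; apply: eq_bigr => j _.
    by rewrite /phase; ring.
  rewrite -sumEFin; over.
rewrite integral_sum//; last first.
  move=> j; under eq_fun do rewrite EFinM.
  by apply: integrableZl => //; exact: integrable_gaussian_cos.
have fin j : (\int[lebesgue_rV R n]_x ((-1) ^+ s j *
    (gaussian t x * cos (2 * pi * dotp x (xi j - zeta))))%:E)%E \is a fin_num.
  apply: integrable_fin_num => //; under eq_fun do rewrite EFinM.
  by apply: integrableZl => //; exact: integrable_gaussian_cos.
rewrite -sum_fine//; apply: eq_bigr => j _; under eq_integral do rewrite EFinM.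
rewrite integralZl//; last exact: integrable_gaussian_cos.
by rewrite fineM//; apply: integrable_fin_num => //; exact: integrable_gaussian_cos.
Qed.

(** Squared modulus of the exponential sum with signs s. *)
Definition energy s (x : 'rV[R]_n) : R := cos_poly s x ^+ 2 + sin_poly s x ^+ 2.

Lemma energy_ge0 s x : 0 <= energy s x.
Proof. by rewrite addr_ge0// sqr_ge0. Qed.

Lemma modulus_test_fun s x :
  modulus (test_fun s) x = (Num.sqrt (energy s x) * gaussian t x)%:E.
Proof.
rewrite /modulus /= !exprMn -mulrDl sqrtrM ?energy_ge0//.
by rewrite sqrtr_sqr ger0_norm// gaussian_ge0.
Qed.

Lemma sum_energy x : \sum_s energy s x = 2 ^+ N * N%:R.
Proof.
rewrite big_split/= !sum_sqr_signed_sum -mulrDr -big_split/=.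
under eq_bigr do rewrite cos2Dsin2.
by rewrite sumr_const card_ord.
Qed.

Lemma energy_le s x : energy s x <= 2 * N%:R ^+ 2.
Proof.
have cs (u : R -> R) : (forall y, `|u y| <= 1) ->
    signed_sum s (fun j => u (phase (xi j) x)) ^+ 2 <= N%:R ^+ 2.
  move=> u1; rewrite -[leLHS]real_normK ?num_real// lerXn2r ?nnegrE//.
  by rewrite -[leRHS]mulr1; apply: norm_signed_sum_le => j.
by rewrite mulr_natl mulr2n lerD// cs// => y; [exact: cos_max|exact: sin_max].
Qed.

Lemma measurable_energy s :
  measurable_fun [set: 'rV[R]_n] (fun x => energy s x : measurableTypeR R).
Proof.
have mph j : measurable_fun [set: 'rV[R]_n] (fun x => phase (xi j) x : measurableTypeR R).
  by apply: measurable_funM => //; exact: measurable_dotp.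
apply: measurable_funD; apply: measurable_funX; apply: measurable_sum => j;
  apply: measurable_funM => //; apply: (measurableT_comp _ (mph j)).
  exact: continuous_measurable_fun (@continuous_cos R).
exact: continuous_measurable_fun (@continuous_sin R).
Qed.

End test_functions.

(** * Mean Lebesgue norms of the test functions *)

Section power_bounds.
Variable R : realType.

(** Linearization of a concave power at X. It replaces Jensen's inequality for
the means over signs. *)
Lemma powR_le_affine (r X y : R) : 0 < r <= 1 -> 0 < X -> 0 <= y ->
  y `^ r <= X `^ r + X `^ (r - 1) * y.
Proof.
move=> /andP[r0 r1] X0 y0; have [yX|Xy] := leP y X.
  apply: ler_wpDr; first by rewrite mulr_ge0// powR_ge0.
  by apply: ge0_ler_powR => //; rewrite ?nnegrE// ltW.
apply: ler_wpDl; first exact: powR_ge0.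
have y1 : 0 < y by exact: lt_trans Xy.
have -> : y `^ r = y `^ (r - 1) * y.
  by rewrite -[X in _ * X]powRr1// -powRD ?subrK// gt_eqF// implybT.
rewrite ler_wpM2r// -opprB !powRN lef_pV2 ?posrE ?powR_gt0//.
by apply: ge0_ler_powR; rewrite ?nnegrE ?subr_ge0// ltW.
Qed.

(** Linear control of the power q = p/2 of the energy y, in terms of the mean N
and of the uniform bound 2 N^2 of the energy. For q <= 1 it is concavity at y = N; for
q >= 1 all but one power of y is bounded uniformly. *)
Lemma powR_energy_bound (q : R) : 0 < q ->
  exists2 D, 0 < D & forall N, (0 < N)%N -> exists A B : R,
    [/\ 0 <= A, 0 <= B, A + B * N%:R <= D * N%:R `^ Num.max q (2 * q - 1) &
     forall y, 0 <= y <= 2 * N%:R ^+ 2 -> y `^ q <= A + B * y].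
Proof.
move=> q0; have [q1|q1] := leP q 1.
  exists 2 => // N N0; have N0' : 0 < N%:R :> R by rewrite ltr0n.
  exists (N%:R `^ q), (N%:R `^ (q - 1)); rewrite !powR_ge0; split => //.
    rewrite -[X in _ + _ * X]powRr1 ?(ltW N0')// -powRD ?subrK; last first.
      by rewrite gt_eqF// implybT.
    have q21 : 2 * q - 1 <= q by lra.
    by rewrite (max_l q21) mulr_natl mulr2n.
  by move=> y /andP[y0 _]; apply: powR_le_affine => //; rewrite q0.
exists (2 `^ (q - 1)); first by rewrite powR_gt0.
move=> N N0; have N0' : 0 < N%:R :> R by rewrite ltr0n.
exists 0, ((2 * N%:R ^+ 2) `^ (q - 1)); rewrite lexx powR_ge0; split => //.
  have q21 : q <= 2 * q - 1 by lra.
  rewrite add0r (max_r q21).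
  rewrite powRM ?exprn_ge0// -mulrA ler_wpM2l ?powR_ge0//.
  rewrite -powR_mulrn// -powRrM -[X in _ * X]powRr1 ?(ltW N0')// -powRD; last first.
    by rewrite (gt_eqF N0') implybT.
  by rewrite (_ : 2%:R * (q - 1) + 1 = 2 * q - 1)//; ring.
move=> y /andP[y0 yN]; rewrite add0r.
have [->|yn0] := eqVneq y 0; first by rewrite powR0 ?gt_eqF// mulr0.
have -> : y `^ q = y `^ (q - 1) * y.
  by rewrite -[X in _ * X]powRr1// -powRD ?subrK// yn0 implybT.
have q1' : 0 <= q - 1 by rewrite subr_ge0 ltW.
by rewrite ler_wpM2r// ge0_ler_powR// nnegrE mulr_ge0// exprn_ge0.
Qed.

End power_bounds.

Section Lnorm_test_functions.
Variables (R : realType) (n : nat).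

(** The p-th powers are averaged first: powR_energy_bound bounds them by an
affine function of the energy, whose mean over the signs is known. Taking the
p-th root of each term is a second use of concavity. *)
Lemma sum_Lnorm_test_fun (p : R) : 1 <= p ->
  exists2 D, 0 <= D & forall N (xi : 'I_N -> 'rV[R]_n) (t : R), (0 < N)%N -> 0 < t ->
  (\sum_(s : {ffun 'I_N -> bool}) 'N[lebesgue_rV R n]_p%:E[modulus (test_fun xi t s)] <=
   (2 ^+ N * (D * N%:R `^ (Num.max (p / 2) (p - 1) / p) *
             gaussian_mass n t `^ p^-1))%:E)%E.
Proof.
move=> p1; have p0 : 0 < p by rewrite (lt_le_trans _ p1).
have p20 : 0 < p / 2 by rewrite divr_gt0.
have [D D0 HD] := powR_energy_bound p20.
pose D1 := D * Num.sqrt p^-1 ^+ n.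
have D10 : 0 < D1 by rewrite mulr_gt0// exprn_gt0// sqrtr_gt0 invr_gt0.
exists (2 * D1 `^ p^-1) => [|N xi t N0 t0]; first by rewrite mulr_ge0// powR_ge0.
have [A [B [A0 B0 ABN HAB]]] := HD N N0.
have pt0 : 0 < p * t by rewrite mulr_gt0.
pose Y s := (\int[lebesgue_rV R n]_x (energy xi s x `^ (p / 2) * gaussian (p * t) x)%:E)%E.
have YE s : ('N[lebesgue_rV R n]_p%:E[modulus (test_fun xi t s)] = Y s `^ p^-1)%E.
  rewrite unlock; congr (_ `^ _)%E; apply: eq_integral => x _.
  rewrite (modulus_test_fun xi t s x) abse_EFin poweR_EFin; congr (_%:E).
  rewrite ger0_norm ?mulr_ge0 ?gaussian_ge0 ?sqrtr_ge0//.
  rewrite powRM ?gaussian_ge0 ?sqrtr_ge0// gaussianX -powR12_sqrt ?energy_ge0//.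
  by rewrite -powRrM [2^-1 * p]mulrC.
pose Z s := (\int[lebesgue_rV R n]_x ((A + B * energy xi s x) * gaussian (p * t) x)%:E)%E.
have Z0 s x : 0 <= (A + B * energy xi s x) * gaussian (p * t) x.
  by rewrite mulr_ge0 ?gaussian_ge0// addr_ge0// mulr_ge0// energy_ge0.
have Y0 s : (0 <= Y s)%E.
  apply: integral_ge0 => x _.
  by rewrite lee_fin mulr_ge0 ?gaussian_ge0// powR_ge0.
have YZ s : (Y s <= Z s)%E.
  apply: le_lower_integral => // x _; rewrite lee_fin//.
    by rewrite mulr_ge0 ?gaussian_ge0// powR_ge0.
  rewrite ler_wpM2r ?gaussian_ge0//; apply: HAB.
  by rewrite energy_ge0 energy_le.
have mZ s : measurable_fun [set: 'rV[R]_n]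
    (fun x => ((A + B * energy xi s x) * gaussian (p * t) x)%:E).
  apply/measurable_EFinP; apply: measurable_funM; last exact: measurable_gaussian.
  apply: measurable_funD => //; apply: measurable_funM => //.
  exact: measurable_energy.
have sumZ : (\sum_(s : {ffun 'I_N -> bool}) Z s =
    (2 ^+ N * ((A + B * N%:R) * gaussian_mass n (p * t)))%:E)%E.
  rewrite -ge0_integral_sum//; last by move=> s x _; rewrite lee_fin.
  rewrite mulrA EFinM -integral_gaussian// -ge0_integralZl_EFin//.
  - apply: eq_integral => x _; rewrite -EFinM sumEFin; congr (_%:E).
    rewrite -mulr_suml big_split/= sumr_const card_ffun card_bool card_ord.
    rewrite -mulr_sumr sum_energy -(mulr_natl A) natrX; ring.
  - by move=> x _; rewrite lee_fin gaussian_ge0.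
  - by apply/measurable_EFinP; exact: measurable_gaussian.
  - by rewrite mulr_ge0 ?exprn_ge0// addr_ge0// mulr_ge0.
pose y s := fine (Y s).
have Yfin s : Y s \is a fin_num.
  rewrite ge0_fin_numE//; apply: le_lt_trans (YZ s) _.
  apply: le_lt_trans (_ : _ <= \sum_(s : {ffun 'I_N -> bool}) Z s)%E _; last by rewrite sumZ ltry.
  rewrite (bigD1 s)//= leeDl// sume_ge0// => s' _; exact: le_trans (Y0 s') (YZ s').
have yE s : Y s = (y s)%:E by rewrite fineK.
have y0 s : 0 <= y s by rewrite fine_ge0.
pose X := D1 * N%:R `^ Num.max (p / 2) (p - 1) * gaussian_mass n t.
have N0' : 0 < N%:R :> R by rewrite ltr0n.
have M0 := gaussian_mass_gt0 n t0.
have X0 : 0 < X by rewrite /X mulr_gt0// mulr_gt0// powR_gt0.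
have sumy : \sum_(s : {ffun 'I_N -> bool}) y s <= 2 ^+ N * X.
  rewrite -lee_fin -sumEFin; under eq_bigr do rewrite -yE.
  apply: le_trans (_ : _ <= \sum_(s : {ffun 'I_N -> bool}) Z s)%E _.
    by apply: lee_sum => s _.
  rewrite sumZ lee_fin ler_wpM2l ?exprn_ge0// gaussian_massM// /X /D1.
  rewrite (_ : D * _ * _ * _ = (D * N%:R `^ Num.max (p / 2) (p - 1)) *
     (Num.sqrt p^-1 ^+ n * gaussian_mass n t)); last by ring.
  rewrite ler_wpM2r ?mulr_ge0 ?exprn_ge0 ?sqrtr_ge0 ?(ltW M0)//.
  by apply: le_trans ABN _; rewrite (_ : 2 * (p / 2) = p)//; field.
under eq_bigr do rewrite YE yE poweR_EFin.
rewrite sumEFin lee_fin.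
have ip : 0 < p^-1 <= 1 by rewrite invr_gt0 p0 invf_le1.
apply: le_trans (_ : \sum_(s : {ffun 'I_N -> bool}) (X `^ p^-1 + X `^ (p^-1 - 1) * y s) <= _).
  by apply: ler_sum => s _; exact: powR_le_affine.
rewrite big_split/= sumr_const card_ffun card_bool card_ord -mulr_sumr.
apply: le_trans (_ : 2 ^+ N * X `^ p^-1 + X `^ (p^-1 - 1) * (2 ^+ N * X) <= _).
  by rewrite -(mulr_natl (X `^ p^-1)) natrX lerD2l ler_wpM2l ?powR_ge0.
have XX : X `^ (p^-1 - 1) * X = X `^ p^-1.
  by rewrite -[Y in _ * Y]powRr1 ?(ltW X0)// -powRD ?subrK// (gt_eqF X0) implybT.
rewrite [Y in _ + Y](_ : _ = 2 ^+ N * X `^ p^-1); last by rewrite -XX; ring.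
rewrite -mulrDr ler_wpM2l ?exprn_ge0// /X.
rewrite !powRM ?mulr_ge0 ?powR_ge0 ?(ltW D0) ?(ltW M0)//.
by rewrite -powRrM; rewrite le_eqVlt; apply/orP; left; apply/eqP; ring.
Qed.

Lemma sum_Lnorm_oo_test_fun N (xi : 'I_N -> 'rV[R]_n) (t : R) : 0 < t ->
  (\sum_(s : {ffun 'I_N -> bool}) 'N[lebesgue_rV R n]_+oo[modulus (test_fun xi t s)] <=
   (2 ^+ N * (2 * N%:R))%:E)%E.
Proof.
move=> t0.
have H s : ('N[lebesgue_rV R n]_+oo[modulus (test_fun xi t s)] <= (2 * N%:R)%:E)%E.
  rewrite unlock; case: ifP => _; last by rewrite lee_fin mulr_ge0.
  apply/ess_supP; apply: aeW => x.
  rewrite -[X in (X <= _)%E]/(abse (modulus (test_fun xi t s) x)).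
  rewrite (modulus_test_fun xi t s x) abse_EFin lee_fin.
  rewrite ger0_norm ?mulr_ge0 ?gaussian_ge0 ?sqrtr_ge0//.
  apply: le_trans (_ : Num.sqrt (energy xi s x) <= _).
    rewrite ler_piMr ?sqrtr_ge0// /gaussian -expR0 ler_expR oppr_le0.
    by rewrite mulr_ge0 ?dotp_ge0// ltW.
  rewrite -[leRHS]ger0_norm ?mulr_ge0// -sqrtr_sqr ler_wsqrtr//.
  apply: le_trans (energy_le _ _ _) _; rewrite exprMn ler_wpM2r ?exprn_ge0//; lra.
apply: le_trans (lee_sum _ (fun s _ => H s)) _.
by rewrite sumEFin sumr_const card_ffun card_bool card_ord -(mulr_natl (2 * N%:R)) natrX.
Qed.

End Lnorm_test_functions.

(** * Differential calculus in coordinates *)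

Section calculus.
Variables (R : realType) (d n : nat).
Implicit Types (phi : 'rV[R]_d -> 'rV[R]_n) (W : set 'rV[R]_d).

Lemma is_derive_line phi (a v : 'rV[R]_d) (t : R) (j : 'I_n) :
  differentiable phi (a + t *: v) ->
  is_derive t 1 (fun s : R => phi (a + s *: v) ord0 j) (('D_v phi (a + t *: v)) ord0 j).
Proof.
move=> /(@diff_derivable _ _ _ _ _ v) dv.
have cv : h^-1 *: (phi (a + (h *: 1 + t) *: v) ord0 j - phi (a + t *: v) ord0 j)
    @[h --> 0^'] --> ('D_v phi (a + t *: v)) ord0 j.
  rewrite (_ : (fun _ => _) = (fun M : 'rV[R]_n => M ord0 j) \o (fun h : R =>
      h^-1 *: ((phi \o shift (a + t *: v)) (h *: v) - phi (a + t *: v)))).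
    exact: continuous_cvg (@coord_continuous _ 1 n ord0 j _) dv.
  apply/funext => h /=; rewrite !mxE; congr (_ * (phi _ _ _ - _)).
  by rewrite scalerDl [_ *: 1]mulr1 addrCA.
have dd : derivable (fun s : R => phi (a + s *: v) ord0 j) t 1.
  by apply/cvg_ex; eexists; exact: cv.
by apply: DeriveDef => //; apply: cvg_lim.
Qed.

(** In the sup norm it suffices to apply the one-variable mean value theorem to
each coordinate of phi along the segment. *)
Lemma mean_value_le phi (a v : 'rV[R]_d) (K : R) :
  (forall t : R, 0 <= t <= 1 -> differentiable phi (a + t *: v)) ->
  (forall t : R, 0 <= t <= 1 -> `|'D_v phi (a + t *: v)| <= K) ->
  `|phi (a + v) - phi a| <= K.
Proof.
move=> dphi bphi.
have K0 : 0 <= K by apply: le_trans (bphi 0 _) => //; rewrite lexx ler01.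
apply/rV_norm_leP => // j; rewrite !mxE.
pose g (s : R) := phi (a + s *: v) ord0 j.
have dg (t : R) : 0 <= t <= 1 -> is_derive t 1 g (('D_v phi (a + t *: v)) ord0 j).
  by move=> t01; apply: is_derive_line; exact: dphi.
have [||c] := @MVT_segment R g (fun t => ('D_v phi (a + t *: v)) ord0 j) 0 1 ler01.
- by move=> t; rewrite in_itv/= => /andP[t0 t1]; apply: dg; rewrite !ltW.
- apply: derivable_within_continuous => t; rewrite in_itv/= => /dg ?.
  exact: ex_derive.
rewrite in_itv/= => c01; rewrite /g scale0r addr0 scale1r subr0 mulr1 => ->.
by rewrite (le_trans (rV_coord_le _ _))// bphi.
Qed.

Lemma derive_sum_partials phi (u v : 'rV[R]_d) : differentiable phi u ->
  'D_v phi u = \sum_i v ord0 i *: 'D_(rV_basis R i) phi u.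
Proof.
move=> dphi; rewrite deriveE// {1}(row_sum_delta v) linear_sum/=.
by apply: eq_bigr => i _; rewrite linearZ/= deriveE.
Qed.

Lemma smooth_on_differentiable W phi u : smooth_on W phi -> W u -> differentiable phi u.
Proof. by move=> /(_ [::]); exact. Qed.

Lemma smooth_on_partial_continuous W phi u i : smooth_on W phi -> W u ->
  {for u, continuous ('D_(rV_basis R i) phi)}.
Proof. by move=> /(_ [:: i] u) H Wu; apply: differentiable_continuous; exact: H. Qed.

(** The partial derivatives are continuous at u0, hence bounded on a ball, which
is convex. *)
Lemma smooth_on_locally_lipschitz W phi u0 : open W -> smooth_on W phi -> W u0 ->
  exists r M : R, [/\ 0 < r, 0 <= M, ball u0 r `<=` W &
    forall a b, ball u0 r a -> ball u0 r b -> `|phi b - phi a| <= M * `|b - a|].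
Proof.
move=> oW sphi Wu0; pose M i : R := `|'D_(rV_basis R i) phi u0| + 1.
have : \forall u \near u0, W u /\ forall i, `|'D_(rV_basis R i) phi u| <= M i.
  have HW : \forall u \near u0, W u by exact: open_nbhs_nbhs.
  have Hi i : \forall u \near u0, `|'D_(rV_basis R i) phi u| <= M i.
    have ci : ('D_(rV_basis R i) phi) @ u0 --> 'D_(rV_basis R i) phi u0.
      exact: (smooth_on_partial_continuous (i := i) sphi Wu0).
    by apply: (@cvgr_norm_le _ _ _ (nbhs u0) _ _ _ ci); rewrite ltrDl.
  have HH : \forall u \near u0, forall i, `|'D_(rV_basis R i) phi u| <= M i.
    exact: (@filter_forall _ _ _ (nbhs u0) _ Hi).
  by apply: filterS2 HW HH => u.
move=> /nbhs_ballP[r /= r0 Hr]; exists r, (\sum_i M i); split => //.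
- by apply: sumr_ge0 => i _; rewrite addr_ge0.
- by move=> u /Hr[].
move=> a b ra rb.
rewrite -[X in phi X - _](_ : a + (b - a) = b); last by rewrite addrC subrK.
have rab (t : R) : 0 <= t <= 1 -> ball u0 r (a + t *: (b - a)).
  move=> /andP[t0 t1]; move: ra rb; rewrite -!ball_normE /ball_/= => ra rb.
  have -> : u0 - (a + t *: (b - a)) = (1 - t) *: (u0 - a) + t *: (u0 - b).
    by apply/matrixP => i j; rewrite !mxE; ring.
  apply: le_lt_trans (ler_normD _ _) _; rewrite !mx_normZ.
  rewrite !ger0_norm ?subr_ge0//.
  have [->|tn0] := eqVneq t 0; first by rewrite subr0 mul1r mul0r addr0.
  have tp : 0 < t by rewrite lt_neqAle eq_sym tn0.
  apply: lt_le_trans (_ : (1 - t) * r + t * r <= _); last by rewrite -mulrDl subrK mul1r.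
  by rewrite ler_ltD ?ltr_pM2l// ler_wpM2l ?subr_ge0// ltW.
apply: mean_value_le => t t01.
  by apply: smooth_on_differentiable sphi _; have [] := Hr _ (rab t t01).
have [Wt Mt] := Hr _ (rab t t01).
rewrite derive_sum_partials; last exact: smooth_on_differentiable sphi _.
rewrite mulr_suml; apply: le_trans (ler_norm_sum _ _ _) _.
apply: ler_sum => i _; rewrite mx_normZ mulrC ler_pM//.
exact: rV_coord_le.
Qed.

End calculus.

(** * Covering numbers of submanifolds *)

Section covering.
Variables (R : realType) (n : nat).
Implicit Types (S : set 'rV[R]_n).

(** Finiteness of the upper Minkowski content of S in dimension d, stated with
nets of mesh O(1/m); the points of a net need not belong to S. *)
Definition covering_bound (d : nat) S := exists (A : nat) (L : R), 0 <= L /\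
  forall m, (0 < m)%N -> exists2 c : seq 'rV[R]_n, (size c <= A * m ^ d)%N &
    forall z, S z -> exists2 y, y \in c & `|y - z| <= L / m%:R.

Lemma covering_boundS d S1 S2 : S1 `<=` S2 -> covering_bound d S2 -> covering_bound d S1.
Proof.
move=> S12 [A [L [L0 H]]]; exists A, L; split => // m m0.
by have [c cA Hc] := H m m0; exists c => // z /S12 /Hc.
Qed.

Lemma covering_bound0 d : covering_bound d set0.
Proof. by exists 0, 0; split => // m _; exists [::]. Qed.

Lemma covering_boundU d S1 S2 : covering_bound d S1 -> covering_bound d S2 ->
  covering_bound d (S1 `|` S2).
Proof.
move=> [A1 [L1 [L10 H1]]] [A2 [L2 [L20 H2]]].
exists (A1 + A2)%N, (Num.max L1 L2); split; first by rewrite le_max L10.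
move=> m m0; have [c1 s1 h1] := H1 m m0; have [c2 s2 h2] := H2 m m0.
exists (c1 ++ c2); first by rewrite size_cat mulnDl leq_add.
by move=> z [/h1|/h2] [y yc yz]; exists y; rewrite ?mem_cat ?yc ?orbT//;
  rewrite (le_trans yz)// ler_wpM2r ?invr_ge0// le_max lexx ?orbT.
Qed.

(** The ball is a cube: cut it into m^d small cubes, and take the images of their
midpoints. *)
Lemma covering_bound_lipschitz d (phi : 'rV[R]_d -> 'rV[R]_n) u0 r M :
  0 < r -> 0 <= M ->
  (forall a b, ball u0 r a -> ball u0 r b -> `|phi b - phi a| <= M * `|b - a|) ->
  covering_bound d (phi @` ball u0 r).
Proof.
move=> r0 M0 lip; exists 1%N, (M * r); split; first by rewrite mulr_ge0// ltW.
move=> m m0; have m0' : 0 < m%:R :> R by rewrite ltr0n.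
have rm0 : 0 < r / m%:R by rewrite divr_gt0.
(* Midpoints of the subcubes, which lie in the open ball where phi is controlled. *)
pose ctr (k : {ffun 'I_d -> 'I_m}) : 'rV[R]_d :=
  \row_i (u0 ord0 i - r + (2 * (k i)%:R + 1) * (r / m%:R)).
exists [seq phi (ctr k) | k <- enum {ffun 'I_d -> 'I_m}].
  by rewrite size_map -cardE card_ffun !card_ord mul1n.
move=> _ [u ur <-].
have ui i : - r < u ord0 i - u0 ord0 i < r.
  rewrite -ltr_norml; move: ur; rewrite -ball_normE /ball_/= distrC.
  by move=> /(rV_norm_ltP _ r0) /(_ i); rewrite !mxE.
pose x i := (u ord0 i - u0 ord0 i + r) / (2 * (r / m%:R)).
have x0 i : 0 <= x i.
  by have /andP[? ?] := ui i; rewrite divr_ge0 ?mulr_ge0 ?(ltW rm0)//; lra.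
have xm j : x j < m%:R.
  have rm2 : 0 < 2 * (r / m%:R) by rewrite mulr_gt0.
  rewrite /x ltr_pdivrMr//.
  rewrite (_ : m%:R * (2 * (r / m%:R)) = 2 * r); last by field; rewrite gt_eqF.
  by have /andP[? ?] := ui j; lra.
have km i : (Num.truncn (x i) < m)%N.
  by rewrite -(ltr_nat R) (le_lt_trans _ (xm i))// truncn_le.
pose k : {ffun 'I_d -> 'I_m} := [ffun i => Ordinal (km i)].
have kx i : (k i)%:R <= x i < (k i)%:R + 1.
  by rewrite ffunE/= truncn_le x0 natr1 truncnS_gt.
have ctrB i : (ctr k - u) ord0 i = (2 * (k i)%:R + 1 - 2 * x i) * (r / m%:R).
  by rewrite !mxE /x; field; rewrite !gt_eqF.
have cu : `|ctr k - u| <= r / m%:R.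
  apply/rV_norm_leP; rewrite ?(ltW rm0)// => i.
  rewrite ctrB normrM (gtr0_norm rm0) ler_piMl ?(ltW rm0)// ler_norml.
  by have /andP[? ?] := kx i; apply/andP; split; lra.
exists (phi (ctr k)); first by apply: map_f; rewrite mem_enum.
rewrite -mulrA; apply: le_trans (lip _ _ ur _) _; last by rewrite ler_wpM2l.
rewrite -ball_normE /ball_/=; apply/rV_norm_ltP => // i.
rewrite !mxE ltr_norml.
have kim : (k i)%:R + 1 <= m%:R :> R by rewrite natr1 ler_nat ltn_ord.
have := ltn_ord (k i); have k0 : 0 <= (k i)%:R :> R by [].
move=> _; move: k0 kim; move: ((k i)%:R : R) => y y0 ym.
have h1 : 0 < (2 * y + 1) * (r / m%:R) by rewrite mulr_gt0//; lra.
have h2 : (2 * y + 1) * (r / m%:R) < 2 * r.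
  rewrite (_ : 2 * r = (2 * m%:R) * (r / m%:R)); last by field; rewrite gt_eqF.
  by rewrite ltr_pM2r//; lra.
by apply/andP; split; lra.
Qed.

Lemma covering_bound_submanifold d (E : set 'rV[R]_n) :
  compact E -> smooth_submanifold d E -> covering_bound d E.
Proof.
move=> cE hE.
have /choice[U HU] : forall x, exists U : set 'rV[R]_n,
    [/\ open U, E x -> U x & covering_bound d (E `&` U)].
  move=> x; have [Ex|nEx] := pselect (E x); last first.
    by exists set0; split => //; rewrite setI0; exact: covering_bound0.
  have [W [phi [[oW sphi _ _ hom] [u0 Wu0 u0x]]]] := hE x Ex.
  have [r [M [r0 M0 rW lip]]] := smooth_on_locally_lipschitz oW sphi Wu0.
  have [V oV phiV] := hom _ (ball_open u0 r) rW.
  exists V; split => //; last by rewrite -phiV; exact: covering_bound_lipschitz lip.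
  move=> _; suff : (E `&` V) x by case.
  by rewrite -phiV; exists u0 => //; exact: ballxx.
move: cE; rewrite compact_cover => /(_ _ E U).
case.
- by move=> x _; have [] := HU x.
- by move=> x Ex; exists x => //; have [_ + _] := HU x; exact.
move=> D _ ED.
apply: (@covering_boundS _ _ (\big[setU/set0]_(x <- finmap.enum_fset D) (E `&` U x))).
  move=> z Ez; have [x /= Dx Uz] := ED z Ez.
  by rewrite -bigcup_seq; exists x.
elim/big_ind : _ => [||x _]; [exact: covering_bound0|exact: covering_boundU|].
by have [] := HU x.
Qed.

End covering.

(** * Surface measure and dimension *)

Section surface_measure.
Variables (R : realType) (d n : nat).
Implicit Types (phi : 'rV[R]_d -> 'rV[R]_n) (W : set 'rV[R]_d) (E : set 'rV[R]_n).

Lemma det_cvg (T : Type) (F : set_system T) (FF : Filter F) m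
    (A : T -> 'M[R]_m) (B : 'M[R]_m) :
  (forall i j, A x i j @[x --> F] --> B i j) -> \det (A x) @[x --> F] --> \det B.
Proof.
move=> AB; rewrite /determinant.
apply: cvg_big => [|s _]; first exact: add_continuous.
apply: cvgM; first exact: cvg_cst.
by apply: cvg_big => [|i _]; [exact: mul_continuous|exact: AB].
Qed.

Lemma gram_cvg (T : Type) (F : set_system T) (FF : Filter F) m q
    (A : T -> 'M[R]_(m, q)) (B : 'M[R]_(m, q)) i j :
  (forall i j, A x i j @[x --> F] --> B i j) ->
  (A x *m (A x)^T) i j @[x --> F] --> (B *m B^T) i j.
Proof.
move=> AB; have gramE (M : 'M[R]_(m, q)) : (M *m M^T) i j = \sum_k M i k * M j k.
  by rewrite mxE; apply: eq_bigr => k _; rewrite mxE.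
rewrite gramE (_ : (fun _ => _) = fun x => \sum_k A x i k * A x j k); last first.
  by apply/funext => x; rewrite gramE.
apply: cvg_big => [|k _]; first exact: add_continuous.
exact: cvgM.
Qed.

Lemma jacobian_partial phi u i j : differentiable phi u ->
  jacobian phi u i j = 'D_(rV_basis R i) phi u ord0 j.
Proof. by move=> dphi; rewrite deriveEjacobian// -rowE [RHS]mxE. Qed.

Lemma gram_volume_cvg W phi u0 : open W -> smooth_on W phi -> W u0 ->
  gram_volume phi u @[u --> u0] --> gram_volume phi u0.
Proof.
move=> oW sphi Wu0.
suff dc : \det (jacobian phi u *m (jacobian phi u)^T) @[u --> u0] -->
    \det (jacobian phi u0 *m (jacobian phi u0)^T).
  exact: (cvg_comp _ _ dc (@sqrt_continuous R _)).
apply: (@det_cvg _ (nbhs (u0 : 'rV[R]_d)) _) => i j.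
have Jc k l : jacobian phi u k l @[u --> u0] --> jacobian phi u0 k l.
  have Pc : 'D_(rV_basis R k) phi u ord0 l @[u --> u0] --> 'D_(rV_basis R k) phi u0 ord0 l.
    have Dc : 'D_(rV_basis R k) phi @ u0 --> 'D_(rV_basis R k) phi u0.
      exact: (smooth_on_partial_continuous (i := k) sphi Wu0).
    exact: (cvg_comp _ _ Dc (@coord_continuous _ 1 n ord0 l _)).
  rewrite -(jacobian_partial k l (smooth_on_differentiable sphi Wu0)) in Pc.
  have HW : \forall u \near u0, W u by exact: open_nbhs_nbhs.
  have PJ : \forall u \near u0,
      'D_(rV_basis R k) phi u ord0 l = jacobian phi u k l.
    apply: filterS HW => u Wu; apply/esym.
    exact: jacobian_partial (smooth_on_differentiable sphi Wu).
  exact: cvg_trans (@near_eq_cvg _ _ (nbhs (u0 : 'rV[R]_d)) _ _ _ PJ) Pc.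
exact: (@gram_cvg _ (nbhs (u0 : 'rV[R]_d))).
Qed.

(** Balls of the sup norm are open cubes. *)
Lemma ball_rV_box (u0 : 'rV[R]_d) r : 0 < r ->
  ball u0 r = box (fun i => [set` `]u0 ord0 i - r, u0 ord0 i + r[]).
Proof.
move=> r0; apply/seteqP; split=> u; rewrite -ball_normE /ball_/=.
  move=> /(rV_norm_ltP _ r0) H i; have := H i; rewrite /= !mxE in_itv/= ltr_norml.
  by move=> /andP[? ?]; apply/andP; split; lra.
move=> H; apply/rV_norm_ltP => // i; have := H i; rewrite /= !mxE in_itv/= ltr_norml.
by move=> /andP[? ?]; apply/andP; split; lra.
Qed.

Lemma lebesgue_ball_gt0 (u0 : 'rV[R]_d) r : 0 < r ->
  measurable (ball u0 r) /\ (0 < lebesgue_rV R d (ball u0 r))%E.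
Proof.
move=> r0; rewrite ball_rV_box//; split.
  by apply: measurable_box => i; exact: measurable_itv.
rewrite lebesgue_rV_box//.
apply: (@big_ind _ (fun x : \bar R => (0 < x)%E)) => // [|i _]; first exact: mule_gt0.
rewrite lebesgue_measure_itv/= lte_fin ifT; last by lra.
by rewrite -EFinB lte_fin; lra.
Qed.

(** In one chart, the volume density is bounded below on a small ball by half of
its value at the centre. *)
Lemma surface_measure_gt0 E (sigma : {measure set 'rV[R]_n -> \bar R}) :
  E !=set0 -> compact E -> smooth_submanifold d E -> is_surface_measure d E sigma ->
  (0 < sigma E)%E.
Proof.
move=> [x Ex] cE hE [_ hsigma].
have [W [phi [hphi [u0 Wu0 u0x]]]] := hE x Ex.
have [oW sphi _ freeJ hom] := hphi.
have [U oU phiW] := hom W oW (fun _ => id).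
have mE := compact_measurable_rV cE.
have mphiW : measurable (phi @` W).
  by rewrite phiW; apply: measurableI => //; exact: open_measurable_rV.
apply: lt_le_trans (_ : _ < sigma (phi @` W))%E _; last first.
  by apply: le_measure; rewrite ?inE// phiW; exact: subIsetl.
have -> : phi @` W = setT `&` phi @` W by rewrite setTI.
rewrite (hsigma W phi hphi setT measurableT) preimage_setT setIT.
pose g0 := gram_volume phi u0.
have g0_gt0 : 0 < g0 by rewrite sqrtr_gt0 det_gram_gt0// freeJ.
have : \forall u \near u0, W u /\ g0 / 2 < gram_volume phi u.
  have HW : \forall u \near u0, W u by exact: open_nbhs_nbhs.
  have Hg : \forall u \near u0, g0 / 2 < gram_volume phi u.
    have gc := gram_volume_cvg oW sphi Wu0.
    by apply: (@cvgr_gt _ _ (nbhs u0) _ _ _ gc); rewrite -/g0; lra.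
  by apply: filterS2 HW Hg => u.
move=> /nbhs_ballP[r /= r0 Hr].
have [mb b0] := lebesgue_ball_gt0 u0 r0.
apply: lt_le_trans (_ : _ < \int[lebesgue_rV R d]_(u in ball u0 r) (g0 / 2)%:E)%E _.
  by rewrite integral_cst// mule_gt0// lte_fin divr_gt0.
apply: le_lower_integral => [u /Hr[]//|u _|u _|u /Hr[_ /ltW]//].
  by rewrite lee_fin divr_ge0// ltW.
by rewrite lee_fin sqrtr_ge0.
Qed.

End surface_measure.

Section codimension_zero.
Variables (R : realType) (d n : nat).

(** At a point of E where the first coordinate is maximal, the gradient of this
coordinate in a chart vanishes, so the differential is not onto R^n; if d = n it
would be, being injective. *)
Lemma submanifold_dim_neq (E : set 'rV[R]_n) : (0 < n)%N ->
  E !=set0 -> compact E -> smooth_submanifold d E -> d != n.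
Proof.
case: n E => // m E _ E0 cE hE; apply/negP => /eqP dm.
have [x Ex xmax] : exists2 x, E x & forall y, E y -> y ord0 ord0 <= x ord0 ord0.
  have [|x Ex H] := @compact_EVT_max _ _ (fun v : 'rV[R]_m.+1 => v ord0 ord0) E E0 cE.
    by apply: continuous_subspaceT => v; exact: coord_continuous.
  by exists x; [rewrite -inE|move=> y Ey; apply: H; rewrite inE].
have [W [phi [[oW sphi _ freeJ hom] [u0 Wu0 u0x]]]] := hE x Ex.
have dphi := smooth_on_differentiable sphi Wu0.
have [V oV phiW] := hom W oW (fun _ => id).
have phiE u : W u -> E (phi u).
  move=> Wu; suff : (E `&` V) (phi u) by case.
  by rewrite -phiW; exists u.
have /nbhs_ballP[r /= r0 rW] : nbhs u0 W by exact: open_nbhs_nbhs.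
have J0 i : jacobian phi u0 i ord0 = 0.
  rewrite (jacobian_partial i ord0 dphi).
  pose v := rV_basis R i; pose g (t : R) := phi (u0 + t *: v) ord0 ord0.
  have v1 : `|v| <= 1.
    by apply/rV_norm_leP => // j; rewrite !mxE; case: (_ && _); rewrite ?normr1 ?normr0.
  have Wt (t : R) : - r < t < r -> W (u0 + t *: v).
    rewrite -ltr_norml => tr; apply: rW; rewrite -ball_normE /ball_/= opprD addNKr normrN.
    by rewrite mx_normZ (le_lt_trans _ tr)// ler_piMr.
  have dg (t : R) : - r < t < r -> is_derive t 1 g ('D_v phi (u0 + t *: v) ord0 ord0).
    by move=> /Wt Wut; apply: is_derive_line; exact: smooth_on_differentiable sphi Wut.
  have rr : - r < 0 < r by apply/andP; split; lra.
  have : is_derive (0 : R) 1 g 0.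
    apply: (@derive1_at_max R g (- r) r 0); rewrite ?in_itv//=.
    - lra.
    - by move=> t; rewrite in_itv/= => /dg ?; exact: ex_derive.
    - move=> t; rewrite in_itv/= => tr; rewrite /g scale0r addr0 u0x.
      by apply/xmax/phiE/Wt.
  have := dg _ rr; rewrite scale0r addr0 => h1 h2.
  by rewrite -(@derive_val _ _ _ _ _ _ _ h1) (@derive_val _ _ _ _ _ _ _ h2).
have /row_fullP[B BJ] : row_full (jacobian phi u0).
  by rewrite /row_full (eqP (freeJ u0 Wu0)) dm.
have := congr1 (fun M : 'M[R]_m.+1 => M ord0 ord0) BJ.
rewrite !mxE big1 => [|i _]; last by rewrite J0 mulr0.
by move=> /eqP; rewrite eq_sym oner_eq0.
Qed.

End codimension_zero.

(** * Failure of the restriction inequality *)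

Section final.
Variables (R : realType) (n : nat).

(** Sum over all signs of the restriction inequality for the test functions,
with its left side bounded below on E by the term of a nearby point of the net. *)
Lemma restriction_lower_bound N (xi : 'I_N -> 'rV[R]_n) (t C : R) (p : \bar R)
    (E : set 'rV[R]_n) (sigma : {measure set 'rV[R]_n -> \bar R}) :
  0 < t -> measurable E ->
  (forall z, E z -> exists j, 4 * pi * n%:R * Num.sqrt 2 ^+ n * `|xi j - z| <= Num.sqrt t) ->
  (forall f, schwartz f -> (\int[sigma]_(z in E) modulus (fourier f) z <=
     C%:E * 'N[lebesgue_rV R n]_p[modulus f])%E) ->
  0 <= C ->
  ((2 ^+ N * (gaussian_mass n t / 2))%:E * sigma E <=
   C%:E * \sum_(s : {ffun 'I_N -> bool}) 'N[lebesgue_rV R n]_p[modulus (test_fun xi t s)])%E.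
Proof.
move=> t0 mE near_xi restr C0.
pose F s z := `|complex.Re (fourier (test_fun xi t s) z)|.
have mF s : measurable_fun E (fun z => (F s z)%:E).
  apply/measurable_EFinP; apply: measurableT_comp => //.
  apply: measurable_funTS; rewrite /F.
  under eq_fun do rewrite Re_fourier_test_fun//.
  apply: measurable_sum => j; apply: measurable_funM => //.
  exact: measurable_cos_kernel.
rewrite ge0_sume_distrr; last by move=> s _; exact: Lnorm_ge0.
apply: le_trans (_ : _ <=
  \sum_(s : {ffun 'I_N -> bool}) \int[sigma]_(z in E) (F s z)%:E)%E _; last first.
  apply: lee_sum => s _; apply: le_trans (restr _ (schwartz_test_fun xi t0 s)).
  apply: le_lower_integral => // z _; rewrite lee_fin ?normr_ge0//.
    by rewrite sqrtr_ge0.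
  rewrite /F; case: (fourier _ _) => x y /=.
  by rewrite -sqrtr_sqr ler_wsqrtr// lerDl sqr_ge0.
rewrite -ge0_integral_sum//; last by move=> s z _; rewrite lee_fin normr_ge0.
rewrite -integral_cst//; apply: le_lower_integral => // z Ez.
- by rewrite lee_fin mulr_ge0 ?exprn_ge0// divr_ge0// ltW// gaussian_mass_gt0.
- by apply: sume_ge0 => s _; rewrite lee_fin normr_ge0.
rewrite sumEFin lee_fin; have [j xij] := near_xi z Ez.
apply: le_trans (_ : 2 ^+ N * `|cos_kernel t (xi j - z)| <= _).
  rewrite ler_wpM2l ?exprn_ge0//; apply: le_trans (ler_norm _).
  exact: cos_kernel_ge.
apply: le_trans (sum_norm_signed_sum_ge j (fun j => cos_kernel t (xi j - z))) _.
by apply: ler_sum => s _; rewrite /F Re_fourier_test_fun.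
Qed.

Lemma power_growth (d : nat) (a b c c0 A D : R) :
  0 < c -> 0 < c0 -> 0 <= A -> 0 <= D -> d%:R * a + n%:R * b < n%:R ->
  ~ (forall m, (0 < m)%N ->
     c0 * (c * m%:R ^+ n) <= D * ((A * m%:R ^+ d) `^ a * (c * m%:R ^+ n) `^ b)).
Proof.
move=> c_gt0 c0_gt0 A0 D0 ab H.
pose e := n%:R - (d%:R * a + n%:R * b); have e0 : 0 < e by rewrite subr_gt0.
pose K := D * (A `^ a * c `^ b) / (c0 * c).
have K0 : 0 <= K by rewrite divr_ge0 ?mulr_ge0 ?powR_ge0// ltW.
have HK m : (0 < m)%N -> m%:R `^ e <= K.
  move=> m0; have m0' : 0 < m%:R :> R by rewrite ltr0n.
  rewrite ler_pdivlMr ?mulr_gt0//.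
  rewrite -(ler_pM2r (powR_gt0 (d%:R * a + n%:R * b) m0')).
  rewrite mulrAC -powRD; last by rewrite (gt_eqF m0') implybT.
  rewrite subrK powR_mulrn ?(ltW m0')//.
  have := H m m0; rewrite !powRM ?exprn_ge0 ?(ltW c_gt0)//.
  rewrite -!powR_mulrn ?(ltW m0')// -!powRrM powRD; last by rewrite (gt_eqF m0') implybT.
  by congr (is_true (_ <= _)); ring.
pose m := (Num.truncn ((K + 1) `^ e^-1)).+1.
have := HK m isT; apply/negP; rewrite -ltNge.
apply: lt_le_trans (_ : K + 1 <= _); first by rewrite ltrDl.
have KE : K + 1 = ((K + 1) `^ e^-1) `^ e.
  by rewrite -powRrM mulVf ?gt_eqF// powRr1// addr_ge0.
have mK : (K + 1) `^ e^-1 <= m%:R by rewrite ltW// truncnS_gt.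
by rewrite KE; apply: ge0_ler_powR; rewrite ?nnegrE ?powR_ge0 ?(ltW e0)//.
Qed.


(** Any bound N^a M^b for the mean norms, with d a + n b < n, contradicts the
lower bound along a sequence of finer and finer nets. *)
Lemma restriction_growth_absurd (d : nat) (E : set 'rV[R]_n)
    (sigma : {measure set 'rV[R]_n -> \bar R}) (p : \bar R) (a b D : R) :
  E !=set0 -> measurable E -> (0 < sigma E)%E -> covering_bound d E ->
  0 <= a -> 0 <= D -> d%:R * a + n%:R * b < n%:R ->
  (forall N (xi : 'I_N -> 'rV[R]_n) (t : R), (0 < N)%N -> 0 < t ->
    (\sum_(s : {ffun 'I_N -> bool}) 'N[lebesgue_rV R n]_p[modulus (test_fun xi t s)] <=
     (2 ^+ N * (D * (N%:R `^ a * gaussian_mass n t `^ b)))%:E)%E) ->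
  ~ p_restriction E sigma p.
Proof.
move=> [x0 Ex0] mE sE [A [L [L0 cover]]] a0 D0 ab Lp [C0 restr0].
(* The constant of the restriction inequality may be negative. *)
pose C := Num.max C0 0; have C_ge0 : 0 <= C by rewrite le_max lexx orbT.
have restr f : schwartz f -> (\int[sigma]_(z in E) modulus (fourier f) z <=
    C%:E * 'N[lebesgue_rV R n]_p[modulus f])%E.
  move=> /restr0 /le_trans; apply; apply: lee_wpmul2r; first exact: Lnorm_ge0.
  by rewrite lee_fin le_max lexx.
have [s s0 sle] : exists2 s : R, 0 < s & (s%:E <= sigma E)%E.
  move: sE; case: (sigma E) => [r| |]//; first by rewrite lte_fin => r0; exists r.
  by move=> _; exists 1 => //; rewrite leey.
(* q is the constant of cos_kernel_ge; Q / m is the value of sqrt t, large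
   enough compared with the mesh L / m. *)
pose q := 4 * pi * n%:R * Num.sqrt 2 ^+ n : R.
have q0 : 0 <= q by rewrite !mulr_ge0 ?pi_ge0// exprn_ge0// sqrtr_ge0.
pose Q := q * L + 1; have Q0 : 0 < Q by rewrite ltr_wpDl// mulr_ge0.
pose c := (Num.sqrt pi / Q) ^+ n.
have c_gt0 : 0 < c by rewrite exprn_gt0// divr_gt0// sqrtr_gt0 pi_gt0.
apply: (@power_growth d a b c (s / 2) A%:R (C * D)) => //.
- by rewrite divr_gt0.
- by rewrite mulr_ge0.
move=> m m0; have m0' : 0 < m%:R :> R by rewrite ltr0n.
have [cs cs_size Hcs] := cover m m0.
set N := size cs in cs_size *.
have N0 : (0 < N)%N by have [y + _] := Hcs x0 Ex0; rewrite /N; case: (cs).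
pose xi (j : 'I_N) := nth 0 cs j.
pose t := (Q / m%:R) ^+ 2.
have Qm0 : 0 < Q / m%:R by rewrite divr_gt0.
have t0 : 0 < t by rewrite exprn_gt0.
have st : Num.sqrt t = Q / m%:R by rewrite sqrtr_sqr gtr0_norm.
have massE : gaussian_mass n t = c * m%:R ^+ n.
  rewrite /gaussian_mass sqrtrM ?pi_ge0// sqrtrV ?(ltW t0)// st -exprMn.
  by congr (_ ^+ _); field; rewrite !gt_eqF.
have near_xi z : E z -> exists j, q * `|xi j - z| <= Num.sqrt t.
  move=> /Hcs[y ycs yz]; have jN : (index y cs < N)%N by rewrite index_mem.
  exists (Ordinal jN); rewrite /xi/= nth_index// st.
  apply: le_trans (_ : q * (L / m%:R) <= _); first by rewrite ler_wpM2l.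
  by rewrite mulrA ler_pM2r ?invr_gt0// lerDl.
have M0 := gaussian_mass_gt0 n t0.
have : ((2 ^+ N * (gaussian_mass n t / 2))%:E * s%:E <=
    C%:E * (2 ^+ N * (D * (N%:R `^ a * gaussian_mass n t `^ b)))%:E)%E.
  apply: le_trans (_ : (2 ^+ N * (gaussian_mass n t / 2))%:E * sigma E <= _)%E.
    apply: lee_wpmul2l => //.
    by rewrite lee_fin mulr_ge0 ?exprn_ge0// divr_ge0 ?(ltW M0).
  apply: le_trans (restriction_lower_bound t0 mE near_xi restr C_ge0) _.
  by apply: lee_wpmul2l; [rewrite lee_fin|exact: Lp].
rewrite -!EFinM lee_fin massE.
rewrite (_ : 2 ^+ N * (c * m%:R ^+ n / 2) * s = 2 ^+ N * (s / 2 * (c * m%:R ^+ n))); last by ring.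
rewrite [C * (2 ^+ N * _)]mulrCA ler_pM2l ?exprn_gt0// => /le_trans; apply.
rewrite -mulrA !ler_wpM2l// ler_wpM2r ?powR_ge0//.
by apply: ge0_ler_powR; rewrite ?nnegrE ?mulr_ge0 ?exprn_ge0// -natrX -natrM ler_nat.
Qed.

End final.

Theorem theorem1p1 (R : realType) (n k : nat) (hn : (2 <= n)%N) (hk : (k <= n)%N)
  (E : set 'rV[R]_n) (hE0 : E !=set0) (hEcompact : compact E)
  (hE : smooth_submanifold (n - k) E)
  (sigma : {measure set 'rV[R]_n -> \bar R})
  (hsigma : is_surface_measure (n - k) E sigma)
  (hf : exists f : 'rV[R]_n -> R[i],
    [/\ compactly_supported_continuous f,
        exists x, f x != 0 &
        forall xi, E xi -> fourier f xi = 0])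
  (p : \bar R) (hp1 : (1 <= p)%E)
  (hp : (((2 * n)%:R / (n + k)%:R : R)%:E < p)%E) :
  ~ p_restriction E sigma p.
Proof.
have n0 : (0 < n)%N by exact: leq_trans hn.
have k0 : (0 < k)%N.
  have := submanifold_dim_neq n0 hE0 hEcompact hE.
  by case: k {hk hE hsigma hp} => //; rewrite subn0 eqxx.
have mE := compact_measurable_rV hEcompact.
have sE := surface_measure_gt0 hE0 hEcompact hE hsigma.
have cE := covering_bound_submanifold hEcompact hE.
have dn : (n - k)%:R = n%:R - k%:R :> R by rewrite natrB.
have k0' : 0 < k%:R :> R by rewrite ltr0n.
have n0' : 0 < n%:R :> R by rewrite ltr0n.
have kn : k%:R <= n%:R :> R by rewrite ler_nat.
case: p hp1 hp => [p| |//] hp1 hp.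
- rewrite lee_fin in hp1; rewrite lte_fin natrM natrD ltr_pdivrMr in hp; last by rewrite addr_gt0.
  (* Since k <= n, the critical exponent 2n/(n+k) is at least 1. *)
  have p1 : 1 < p.
    rewrite ltNge; apply/negP => ple1.
    have : p * (n%:R + k%:R) <= 2 * n%:R.
      apply: le_trans (_ : 1 * (n%:R + k%:R) <= _); last by lra.
      by rewrite ler_wpM2r// addr_ge0.
    by rewrite leNgt hp.
  have p0 : 0 < p by lra.
  have [D D0 HD] := sum_Lnorm_test_fun n hp1.
  apply: (restriction_growth_absurd (a := Num.max (p / 2) (p - 1) / p) (b := p^-1)
    hE0 mE sE cE _ D0) => //.
  - by rewrite divr_ge0// ?le_max ?(ltW p0)// divr_ge0 ?(ltW p0).
  - rewrite mulrA -mulrDl ltr_pdivrMr// dn.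
    have d0 : 0 <= n%:R - k%:R :> R by rewrite subr_ge0.
    rewrite maxr_pMr// -ltrBrDr gt_max; apply/andP; split; first by lra.
    rewrite -subr_gt0 (_ : _ - _ = k%:R * (p - 1)); last by ring.
    by rewrite mulr_gt0// subr_gt0.
  - by move=> N xi t N0 t0; rewrite [D * (_ * _)]mulrA; exact: HD.
- apply: (restriction_growth_absurd (a := 1) (b := 0) (D := 2) hE0 mE sE cE) => //.
  + by rewrite mulr1 mulr0 addr0 dn; lra.
  + move=> N xi t _ t0; rewrite powRr1// powRr0 mulr1.
    exact: sum_Lnorm_oo_test_fun.
Qed.
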